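(* Let $(F,r)$ be a connected regular rooted graph whose distance partition at $r$ is equitable, let $D=\operatorname{ecc}(r)\ge1$, and let $\Theta$ be the local spectral support of $(F,r)$. Let $m\ge1$ and let $a=(r,\ldots,r)$ in the $m$-fold Cartesian power $F^{\square m}$. Then $$P_a=\mathbb R[B]\mathbf 1,\qquad \dim P_a=|m\Theta|-1\ge mD .$$ For $m\ge2$, the equality $\dim P_a=mD$ holds if and only if $\Theta$ is an arithmetic progression. If $F$ is distance-regular, then $D=\operatorname{diam}(F)$ and $\Theta$ is the full set of distinct adjacency eigenvalues of $F$.
   Context: All graphs are finite and simple; all vector spaces and algebras are over $\mathbb R$. $\operatorname{ecc}(r)$ is the eccentricity (maximum distance from $r$). The distance partition at $r$ is the partition of $V(F)$ into spheres $S_j(r)$, $0\le j\le\operatorname{ecc}(r)$; it is equitable if the number of neighbours of a vertex in a given cell depends only on the cell containing the vertex. The local spectral support is $\Theta=\{\theta:E_\theta e_r\neq0\}$, where $E_\theta$ is the orthogonal projection onto the $\theta$-eigenspace of the adjacency matrix of $F$ and $e_r$ is the standard basis vector at $r$. For a finite set $S\subseteq\mathbb R$, $mS=\{s_1+\cdots+s_m:s_i\in S\}$, repetitions allowed. For a connected regular graph $G$ with at least two vertices and $a\in V(G)$ (here $G=F^{\square m}$): $B=A(G-a)$ is the adjacency matrix of the vertex-deleted graph, $E$ is the diagonal matrix indexed by $V(G)\setminus\{a\}$ with diagonal the indicator of the neighbourhood $N(a)$, $\mathbf 1$ is the all-ones vector on $V(G)\setminus\{a\}$, $\mathcal B_a=\langle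 I,B,E\rangle$ is the real unital algebra generated by $B$ and $E$, $P_a=\mathcal B_a\mathbf 1$, and $\mathbb R[B]\mathbf 1$ is the span of all $B^k\mathbf 1$, $k\ge0$. *)

(* Defs.v *)
From HB Require Import structures.
From mathcomp Require Import all_boot all_order all_algebra finmap.
From mathcomp Require Import all_classical reals.

Set Implicit Arguments.
Unset Strict Implicit.
Unset Printing Implicit Defensive.
Import Order.TTheory GRing.Theory Num.Theory.
Local Open Scope ring_scope.

(* A finite simple graph is a symmetric irreflexive [e : rel T], [T : finType]. *)
Section Graphs.
Variable T : finType.
Implicit Types (e : rel T) (x y : T).

Definition simple_graph e := symmetric e /\ irreflexive e.

Definition connected_graph e := forall x y, connect e x y.

Definition nbhd e x : {set T} := [set y | e x y]%SET.

Definition regular_graph e := exists k, forall x, #|nbhd e x| = k.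

(* The least length of a walk from [x] to [y]; it is [#|T|] if there is none. *)
Definition gdist e x y : nat :=
  find (fun k => [exists p : k.-tuple T, path e x p && (last x p == y)])
       (iota 0 #|T|).

Definition ecc e x : nat := (\max_(y : T) gdist e x y)%N.

Definition diam e : nat := (\max_(x : T) ecc e x)%N.

Definition sphere e x (j : nat) : {set T} := [set y | gdist e x y == j]%SET.

Definition distance_partition e x : {set {set T}} :=
  [set sphere e x j | j : 'I_(ecc e x).+1]%SET.

Definition equitable e (P : {set {set T}}) :=
  forall C C' : {set T}, C \in P -> C' \in P ->
  forall x y, x \in C -> y \in C ->
    #|(nbhd e x :&: C')%SET| = #|(nbhd e y :&: C')%SET|.

(* [b] and [c] give the intersection numbers. *)
Definition distance_regular e :=
  connected_graph e /\
  exists b c : nat -> nat, forall x y,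
    #|[set z in nbhd e y | gdist e x z == (gdist e x y).+1]%SET|
      = b (gdist e x y) /\
    #|[set z in nbhd e y | (gdist e x z).+1 == gdist e x y]%SET|
      = c (gdist e x y).

(* Edge relation of the m-fold Cartesian power, on the m-tuples of vertices. *)
Definition cart_pow e (m : nat) : rel {ffun 'I_m -> T} :=
  fun u v => [exists i, e (u i) (v i) && [forall j, (j != i) ==> (u j == v j)]].

Definition del_vertex e (a : T) : rel {x : T | x != a} :=
  relpre val e.

End Graphs.

Section Spectra.
Variable R : realType.

(* Rows and columns are indexed by the vertices through [enum_val]. *)
Definition adjmx (T : finType) (e : rel T) : 'M[R]_#|T| :=
  \matrix_(i, j) (e (enum_val i) (enum_val j))%:R.

(* Orthogonal projection onto the row space of [U], acting on row vectors by
   right multiplication; the row space of [kermx U^T] is the orthogonal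
   complement of that of [U]. *)
Definition orthproj n (U : 'M[R]_n) : 'M[R]_n := proj_mx U (kermx U^T).

Lemma cap_kermx_tr n (U : 'M[R]_n) : (U :&: kermx U^T = 0)%MS.
Proof.
apply/eqP; rewrite -submx0; apply/rV_subP => v.
rewrite sub_capmx => /andP[/submxP[w ->]] /sub_kermxP h.
have : (w *m U) *m (w *m U)^T = 0 by rewrite trmx_mul mulmxA h mul0mx.
move=> /matrixP/(_ ord0 ord0); rewrite mxE [RHS]mxE => /eqP.
rewrite psumr_eq0 => [/allP z|i _]; last by rewrite [_^T _ _]mxE -expr2 sqr_ge0.
apply/submxP; exists 0; rewrite mul0mx; apply/rowP => i; rewrite [RHS]mxE.
have := z i (mem_index_enum i).
by rewrite [_^T _ _]mxE -expr2 sqrf_eq0 => /eqP.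
Qed.

Lemma orthproj_sub n (U : 'M[R]_n) (v : 'rV[R]_n) : (v *m orthproj U <= U)%MS.
Proof. exact: proj_mx_sub. Qed.

Lemma orthproj_compl n (U : 'M[R]_n) (v : 'rV[R]_n) :
  (v - v *m orthproj U) *m U^T = 0.
Proof.
apply/sub_kermxP; apply: proj_mx_compl_sub.
apply: (submx_trans (submx1 v)); rewrite sub1mx /row_full.
have := mxrank_sum_cap U (kermx U^T).
rewrite cap_kermx_tr mxrank0 addn0 => ->.
by rewrite mxrank_ker mxrank_tr subnKC // rank_leq_col.
Qed.

Local Open Scope classical_set_scope.

Definition local_support (T : finType) (e : rel T) (r : T) : set R :=
  [set theta | (delta_mx 0 (enum_rank r) : 'rV[R]_#|T|)
                 *m orthproj (eigenspace (adjmx e) theta) != 0].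

Definition spectrum (T : finType) (e : rel T) : set R :=
  [set theta | eigenvalue (adjmx e) theta].

Definition msumset (m : nat) (S : set R) : set R :=
  [set \sum_(i < m) s i | s in [set s : 'I_m -> R | forall i, S (s i)]].

Definition arith_prog (S : set R) :=
  exists (c d : R) (k : nat), 0 < d /\ S = [set c + d *+ i | i in `I_k].

(* Intersection of an arbitrary family of subspaces. *)
Lemma vcap_ex (V : vectType R) (C : set {vspace V}) :
  exists W : {vspace V}, forall v, v \in W <-> (forall U, C U -> v \in U).
Proof.
pose P d := `[< exists s : seq {vspace V}, (forall U, U \in s -> C U) /\
                  \dim (\bigcap_(U <- s) U)%VS = d >].
have exP : exists d, P d.
  by exists (\dim {:V}); apply/asboolP; exists [::]; rewrite big_nil.
case: (ex_minnP exP) => d /asboolP[s [sC ds]] dmin.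
exists (\bigcap_(U <- s) U)%VS => v; split=> [vs U CU|vC].
  have: P (\dim (U :&: \bigcap_(W <- s) W)%VS).
    apply/asboolP; exists (U :: s); rewrite big_cons; split=> // W.
    by rewrite inE => /predU1P[->|/sC].
  move=> /dmin; rewrite -ds => le.
  have /eqP E : (U :&: \bigcap_(W <- s) W == \bigcap_(W <- s) W)%VS.
    by rewrite eqEdim capvSr.
  by move: vs; rewrite -E memv_cap => /andP[].
elim: s sC {ds} => [|U s IH] sC; first by rewrite big_nil memvf.
rewrite big_cons memv_cap vC ?IH // => [W Ws|]; apply: sC.
  by rewrite inE Ws orbT.
by rewrite inE eqxx.
Qed.

Definition vcap (V : vectType R) (C : set {vspace V}) : {vspace V} :=
  sval (cid (vcap_ex C)).

Lemma memv_vcap (V : vectType R) (C : set {vspace V}) v :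
  v \in vcap C <-> (forall U, C U -> v \in U).
Proof. exact: svalP (cid (vcap_ex C)) v. Qed.

Definition lin_span (V : vectType R) (S : set V) : {vspace V} :=
  vcap [set U | S `<=` [set` U]].

Definition unital_subalg n (U : {vspace 'M[R]_n}) :=
  1%:M \in U /\ forall X Y, X \in U -> Y \in U -> X *m Y \in U.

Definition gen_alg n (S : set 'M[R]_n) : {vspace 'M[R]_n} :=
  vcap [set U | unital_subalg U /\ S `<=` [set` U]].

(* In the usual notation: [delB], [delE], [delone] are B, E and the all-ones
   vector on V(g) \ {a}; [delalg] is <I, B, E>, [delP] is <I, B, E>1 and
   [delK] is R[B]1. *)
Section VertexDeleted.
Variables (V : finType) (g : rel V) (a : V).

Local Notation W := {x : V | x != a}.

Definition delB : 'M[R]_#|{: W}| := adjmx (del_vertex g (a := a)).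

Definition delE : 'M[R]_#|{: W}| :=
  diag_mx (\row_i (g a (val (enum_val i)))%:R).

Definition delone : 'cV[R]_#|{: W}| := const_mx 1.

Definition delalg : {vspace 'M[R]_#|{: W}|} := gen_alg [set delB; delE].

Definition delP : {vspace 'cV[R]_#|{: W}|} :=
  (linfun (mulmxr delone) @: delalg)%VS.

Lemma delPE v : v \in delP <-> exists2 X, X \in delalg & v = X *m delone.
Proof.
split=> [/memv_imgP[X XA ->]|[X XA ->]]; first by exists X; rewrite // lfunE.
apply/memv_imgP; exists X => //; exact/esym/(lfunE (mulmxr delone)).
Qed.

Definition delK : {vspace 'cV[R]_#|{: W}|} :=
  lin_span [set delB ^+ k *m delone | k in [set: nat]].

End VertexDeleted.

End Spectra.

Arguments local_support R {T} e r _.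
Arguments spectrum R {T} e _.

(* Main.v *)
From HB Require Import structures.
Require Import Defs.
From mathcomp Require Import all_boot all_order all_algebra finmap.
From mathcomp Require Import all_classical reals.
From mathcomp Require Import perm zify lra.

(** Write A for the adjacency matrix of G = F^m and Z = R[A] e_a for the span
    of all A^k e_a. The proof compares P_a and R[B]1 with Z.

    Decompose e_r = sum of w_l over l in Theta, where w_l is the projection of
    e_r onto the l-eigenspace of F; this needs the real spectral theorem
    ([symmx_spectral_decomp]). Then e_a is the tensor power of e_r, and
    collecting the tensors of the w_l according to the sum of their eigenvalues
    writes e_a as a sum of eigenvectors of A, one for each x in m Theta. None of
    them vanishes, because w_l(r) = |w_l|^2 > 0 makes every tensor positive at a
    ([sum_eigenvector_neq0]). A sum of eigenvectors with distinct eigenvalues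
    generates the span of its terms ([eigen_components]), hence Z is spanned by
    these eigenvectors and dim Z = |m Theta|.

    Restriction to V(G) \ {a} maps Z onto R[B]1 with kernel the line of e_a
    ([delK_restr]): deleting a only changes A by multiples of A e_a, whose
    restriction E1 = K1 - B1 is in R[B]1 since G is K-regular. One also needs
    that Z contains 1. On F, the span of the w_l consists of all functions of
    the distance to r ([local_support_structure]), so it contains 1, which is
    then a multiple of w_k for the degree k; as k is the largest element of
    Theta, m k is attained by one tensor only, and its eigenvector is constant
    ([sum_space_one]). Therefore dim R[B]1 = |m Theta| - 1.

    The equality P_a = R[B]1 holds because R[B]1 is stable under E: a function
    of Z is symmetric in the coordinates and depends only on the distances to r,
    so it is constant on N(a) and E sends its restriction to a multiple of E1
    ([sum_space_nbhd_const], [delP_eq_delK]).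

    Functions of the distance to r form a space of dimension D + 1, whence
    |Theta| = D + 1, and the inequality with its equality case is a statement on
    sumsets of reals ([sumset_size_ge], [sumset_eq_arith_prog],
    [arith_prog_sumset_size]). For a distance-regular F, a polynomial in the
    adjacency matrix that kills one basis vector kills all of them
    ([annihilating_base_eigenvalue]), so no eigenvalue is missing from Theta. *)

(** * The spectral theorem for real symmetric matrices *)

Section SymmetricSpectrum.
Set Implicit Arguments.
Unset Strict Implicit.
Import Order.TTheory GRing.Theory Num.Theory.
Local Open Scope ring_scope.
Variable R : realType.

Local Notation sq v := ((v *m v^T) ord0 ord0).

Lemma sqE n (v : 'rV[R]_n) : sq v = \sum_i v ord0 i ^+ 2.
Proof. by rewrite mxE; apply: eq_bigr => i _; rewrite mxE expr2. Qed.

Lemma sq_ge0 n (v : 'rV[R]_n) : 0 <= sq v.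
Proof. by rewrite sqE sumr_ge0 // => i _; exact: sqr_ge0. Qed.

Lemma sq_eq0 n (v : 'rV[R]_n) : (sq v == 0) = (v == 0).
Proof.
apply/idP/eqP => [|->]; last by rewrite mul0mx mxE.
rewrite sqE psumr_eq0 => [/allP z|i _]; last exact: sqr_ge0.
apply/rowP => i; rewrite [RHS]mxE; have := z i (mem_index_enum i).
by rewrite sqrf_eq0 => /eqP.
Qed.

Lemma quad_scalar_sub n (A : 'M[R]_n) (l : R) (v : 'rV_n) :
  (v *m (l%:M - A) *m v^T) ord0 ord0 = l * sq v - (v *m A *m v^T) ord0 ord0.
Proof.
rewrite mulmxBr mul_mx_scalar mulmxBl -scalemxAl mxE; congr (_ + _); first by rewrite mxE.
by rewrite [LHS]mxE.
Qed.

(** The summand 1 in the constant only serves to make it positive. *)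
Lemma bilinear_bound n (A : 'M[R]_n) :
  exists2 K : R, 0 < K & forall v : 'rV_n, (v *m A *m v^T) ord0 ord0 <= K * sq v.
Proof.
exists (1 + \sum_i \sum_j `|A i j|) => [|v].
  by rewrite ltr_pwDl // sumr_ge0 // => i _; rewrite sumr_ge0.
have bnd i : v ord0 i ^+ 2 <= sq v.
  by rewrite sqE (bigD1 i) //= lerDl sumr_ge0 // => j _; exact: sqr_ge0.
have -> : (v *m A *m v^T) ord0 ord0 = \sum_i \sum_j v ord0 i * A i j * v ord0 j.
  rewrite exchange_big mxE; apply: eq_bigr => j _.
  by rewrite !mxE mulr_suml; apply: eq_bigr => i _.
rewrite mulrDl mul1r ler_wpDl ?sq_ge0 // mulr_suml; apply: ler_sum => i _.
rewrite mulr_suml; apply: ler_sum => j _; apply: le_trans (ler_norm _) _.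
rewrite mulrAC normrM mulrC ler_wpM2l //.
have := bnd i; have := bnd j; rewrite normrM.
have := sqr_ge0 (`|v ord0 i| - `|v ord0 j|).
rewrite -[v ord0 i ^+ 2]real_normK ?num_real // -[v ord0 j ^+ 2]real_normK ?num_real //.
by nra.
Qed.

(** The supremum l of the Rayleigh quotient on W is an eigenvalue, by an
    argument that needs no compactness. The form of M = l - A is nonnegative on
    W. If M were injective on W, it would map W onto W, and every v in W would
    be w M with <v, w> <= C |v|^2; then nonnegativity at v - C^-1 w gives
    <v M, v> >= C^-1 |v|^2, so that l - C^-1 would already be an upper bound. *)
Lemma stable_eigenvector n (A W : 'M[R]_n) : A^T = A ->
  (W *m A <= W)%MS -> W != 0 ->
  exists l, exists2 v : 'rV_n, v != 0 & (v <= W)%MS /\ v *m A = l *: v.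
Proof.
move=> As WA W0.
pose S := [set x : R | exists v : 'rV_n,
  [/\ (v <= W)%MS, v != 0 & (v *m A *m v^T) ord0 ord0 = x * sq v]]%classic.
have [K K0 KP] := bilinear_bound A.
have supS : has_sup S.
  split.
    have /rowV0Pn[i iW i0] := W0.
    exists ((i *m A *m i^T) ord0 ord0 / sq i), i; split => //.
    by rewrite divfK // sq_eq0.
  exists K => x [v [vW v0 vx]].
  by rewrite -(ler_pM2r (_ : 0 < sq v)) ?lt_def ?sq_eq0 ?v0 ?sq_ge0 // -vx.
pose l := sup S; pose M := l%:M - A.
have M_ge0 (v : 'rV_n) : (v <= W)%MS -> 0 <= (v *m M *m v^T) ord0 ord0.
  move=> vW; have [->|v0] := eqVneq v 0; first by rewrite !mul0mx mxE.
  rewrite quad_scalar_sub subr_ge0.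
  rewrite -ler_pdivrMr; last by rewrite lt_def sq_eq0 v0 sq_ge0.
  apply: (sup_upper_bound supS); exists v; split => //.
  by rewrite divfK // sq_eq0.
have Ms : M^T = M by rewrite linearB /= tr_scalar_mx As.
have [WM|] := eqVneq (W :&: kermx M)%MS 0; last first.
  move=> /rowV0Pn[v]; rewrite sub_capmx => /andP[vW /sub_kermxP].
  rewrite mulmxBr mul_mx_scalar => /eqP; rewrite subr_eq0 => /eqP vE v0.
  by exists l, v.
have WMW : (W *m M <= W)%MS.
  by rewrite mulmxBr mul_mx_scalar addmx_sub ?scalemx_sub // eqmx_opp.
have rk : \rank (W *m M) = \rank W by have := mxrank_mul_ker W M; rewrite WM mxrank0 addn0.
have /submxP[G GE] : (W <= W *m M)%MS.
  by have := mxrank_leqif_sup WMW; rewrite rk => /leqifP; case: ifP => //; rewrite ltnn.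
have [C C0 CP] := bilinear_bound (pinvmx W *m G *m W).
suff : l <= l - C^-1 by rewrite lerDl oppr_ge0 invr_le0 leNgt C0.
apply: sup_le_ub; first exact: supS.1.
move=> x [v [vW v0 vx]].
have sv0 : 0 < sq v by rewrite lt_def sq_eq0 v0 sq_ge0.
pose w := v *m (pinvmx W *m G *m W).
have wW : (w <= W)%MS by rewrite /w mulmxA submxMl.
have wM : w *m M = v.
  have -> : w = v *m pinvmx W *m G *m W by rewrite /w !mulmxA.
  by rewrite -(mulmxA _ W M) -(mulmxA _ G) -GE mulmxKpV.
have cw : (w *m v^T) ord0 ord0 <= C * sq v by exact: CP.
clearbody w.
(* The step C^-1 minimises the bound a - 2 t |v|^2 + t^2 C |v|^2 over t. *)
have := M_ge0 (v - C^-1 *: w); rewrite addmx_sub ?eqmx_opp ?scalemx_sub // => /(_ isT).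
have -> : ((v - C^-1 *: w) *m M *m (v - C^-1 *: w)^T) ord0 ord0 =
   (v *m M *m v^T) ord0 ord0 - C^-1 * sq v *+ 2 + C^-1 ^+ 2 * (w *m v^T) ord0 ord0.
  have e1 : v *m M *m w^T = v *m v^T by rewrite -mulmxA -[M]Ms -trmx_mul wM.
  have e2 : v *m w^T = (w *m v^T)^T by rewrite trmx_mul trmxK.
  have -> : (v - C^-1 *: w)^T = v^T - C^-1 *: w^T by rewrite linearB linearZ.
  rewrite [(v - _) *m M]mulmxBl -scalemxAl wM mulmxBr !mulmxBl.
  rewrite -!scalemxAr -!scalemxAl e1 e2; move: (v *m M *m v^T) (v *m v^T) (w *m v^T) => a b d.
  rewrite !mxE.
  by lra.
rewrite quad_scalar_sub vx.
have Ci0 : 0 < C^-1 by rewrite invr_gt0.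
have : C^-1 ^+ 2 * (w *m v^T) ord0 ord0 <= C^-1 * sq v.
  rewrite expr2 -mulrA; apply: ler_wpM2l; first exact: ltW.
  by rewrite -(ler_pM2l C0) mulrA divff ?mul1r // gt_eqF.
move=> le1 le2; rewrite -(ler_pM2r sv0) mulrBl.
by lra.
Qed.

(** Split off one eigenvector and continue in its orthogonal complement, which
    is stable because A is symmetric. *)
Lemma stable_sub_eigenspaces n (A W : 'M[R]_n) : A^T = A ->
  (W *m A <= W)%MS -> exists rs, (W <= \sum_(r <- rs) eigenspace A r)%MS.
Proof.
move=> As; elim: (\rank W).+1 {-2}W (ltnSn (\rank W)) => // k IH {}W rW WA.
have [->|W0] := eqVneq W 0; first by exists [::]; rewrite sub0mx.
have [l [v v0 [vW vA]]] := stable_eigenvector As WA W0.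
pose W' := (W :&: kermx v^T)%MS.
have W'A : (W' *m A <= W')%MS.
  rewrite sub_capmx (submx_trans (submxMr _ (capmxSl _ _)) WA) /=.
  apply/sub_kermxP; rewrite -mulmxA -[A]As -trmx_mul vA linearZ /= -scalemxAr.
  by have /sub_kermxP -> : (W' <= kermx v^T)%MS by [exact: capmxSr]; rewrite scaler0.
have sv0 : sq v != 0 by rewrite sq_eq0.
have rW' : (\rank W' < k)%N.
  rewrite -ltnS; apply: leq_trans rW; rewrite ltnS.
  have : (W' < W)%MS.
    rewrite /ltmx capmxSl /=; apply: contra sv0 => WW'.
    have /sub_kermxP -> : (v <= kermx v^T)%MS.
      exact: submx_trans vW (submx_trans WW' (capmxSr _ _)).
    by rewrite mxE.
  by rewrite ltmxErank => /andP[].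
have [rs rsP] := IH _ rW' W'A.
exists (l :: rs); rewrite big_cons; apply/rV_subP => x xW.
pose c := (x *m v^T) ord0 ord0 / sq v.
rewrite -[x](subrK (c *: v)) addrC addmx_sub_adds //.
  by rewrite scalemx_sub //; apply/eigenspaceP.
apply: submx_trans rsP; rewrite sub_capmx addmx_sub ?eqmx_opp ?scalemx_sub //=.
apply/sub_kermxP; rewrite mulmxBl -scalemxAl.
by rewrite (mx11_scalar (x *m _)) (mx11_scalar (v *m _)) scale_scalar_mx divfK ?subrr.
Qed.

Lemma symmx_sum_eigenspaces n (A : 'M[R]_n) : A^T = A ->
  exists2 rs, uniq rs & (1%:M <= \sum_(r <- rs) eigenspace A r)%MS.
Proof.
move=> As; have [|rs rsP] := @stable_sub_eigenspaces n A 1%:M As; first exact: submx1.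
exists (undup rs); first exact: undup_uniq.
apply: submx_trans rsP _; elim: rs => //= r rs IH; rewrite big_cons.
case: ifP => rrs; last by rewrite big_cons addsmxS.
rewrite addsmx_sub IH andbT; move: rrs; rewrite -mem_undup => rrs.
by rewrite (big_rem r) //= addsmxSl.
Qed.

Lemma symmx_eigen_ortho n (A U W : 'M[R]_n) (l k : R) : A^T = A -> l != k ->
  (U <= eigenspace A l)%MS -> (W <= eigenspace A k)%MS -> U *m W^T = 0.
Proof.
move=> As lk /eigenspaceP UE /eigenspaceP WE.
have : U *m A *m W^T = U *m (W *m A)^T by rewrite trmx_mul As mulmxA.
rewrite UE WE linearZ /= -scalemxAl -scalemxAr => /eqP.
by rewrite -subr_eq0 -scalerBl scaler_eq0 subr_eq0 (negbTE lk) => /eqP.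
Qed.

Lemma orthproj_unique n (U : 'M[R]_n) (u v : 'rV[R]_n) :
  (u <= U)%MS -> (v - u) *m U^T = 0 -> v *m orthproj U = u.
Proof.
move=> uU vuU; rewrite -[v](subrK u) mulmxDl /orthproj.
by rewrite proj_mx_0 ?proj_mx_id ?add0r ?cap_kermx_tr //; apply/sub_kermxP.
Qed.

(** Eigenspaces for distinct eigenvalues are orthogonal, so any decomposition of
    v along them is the one given by the orthogonal projections. *)
Lemma symmx_spectral_decomp n (A : 'M[R]_n) (v : 'rV[R]_n) : A^T = A ->
  exists s : seq R, [/\ uniq s,
    forall l, (l \in s) = (v *m orthproj (eigenspace A l) != 0) &
    v = \sum_(l <- s) v *m orthproj (eigenspace A l)].
Proof.
move=> As; have [rs urs rsE] := symmx_sum_eigenspaces As.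
have := submx_trans (submx1 v) rsE.
rewrite (big_nth 0) big_mkord => /sub_sumsmxP[u vE].
pose w i := u i *m eigenspace A rs`_i.
have projE l : v *m orthproj (eigenspace A l)
  = \sum_(i < size rs | rs`_i == l) w i.
  apply: orthproj_unique.
    apply: summx_sub => i /eqP <-; exact: submxMl.
  rewrite vE (bigID (fun i : 'I__ => rs`_i == l)) /= addrC addrK mulmx_suml.
  apply: big1 => i il; rewrite -mulmxA.
  by rewrite (symmx_eigen_ortho As il (submx_refl _) (submx_refl _)) mulmx0.
exists [seq l <- rs | v *m orthproj (eigenspace A l) != 0]; split.
- exact: filter_uniq.
- move=> l; rewrite mem_filter andbC; case: (boolP (l \in rs)) => //= lrs.
  apply/esym/negbTE; rewrite projE big_pred0 ?eqxx // => i.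
  by apply: contraNF lrs => /eqP <-; exact: mem_nth.
- rewrite big_filter [RHS]big_rmcond /=; last by move=> l /negPn/eqP.
  rewrite [RHS](big_nth 0) big_mkord {1}vE; apply: eq_bigr => i _.
  rewrite projE (bigD1 i) //= big1 ?addr0 // => j /andP[ji ij]; case/negP: ij.
  by rewrite -val_eqE /= -(nth_uniq 0 (ltn_ord j) (ltn_ord i) urs).
Qed.

End SymmetricSpectrum.

(** * Sums of eigenvectors and the adjacency operator *)

Section EigenFamilies.
Set Implicit Arguments.
Unset Strict Implicit.
Import Order.TTheory GRing.Theory Num.Theory.
Local Open Scope ring_scope.
Variables (K : fieldType) (V : vectType K) (A : {linear V -> V}).
Implicit Types (U : {vspace V}) (s : seq K) (w : K -> V).

(** The vector A v - k v has no k-component, which removes one eigenvalue from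
    the sum; induct on the number of eigenvalues. *)
Lemma eigen_components U s w : uniq s ->
    {in s, forall l, A (w l) = l *: w l} ->
    {in U, forall u, A u \in U} -> \sum_(l <- s) w l \in U ->
  {in s, forall l, w l \in U}.
Proof.
move=> us Aw UA; elim: s us w Aw => // k s IH /= /andP[ks us] w Aw.
rewrite big_cons => sU.
have wU : {in s, forall l, w l \in U}.
  have lk l : l \in s -> l - k != 0.
    by move=> ls; rewrite subr_eq0; apply: contraNneq ks => <-.
  have wk : {in s, forall l, (l - k) *: w l \in U}.
    apply: IH => // [l ls|].
      by rewrite linearZ /= Aw ?inE ?ls ?orbT // !scalerA mulrC.
    have -> : \sum_(l <- s) (l - k) *: w l =
              A (w k + \sum_(l <- s) w l) - k *: (w k + \sum_(l <- s) w l).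
      rewrite linearD linear_sum /= Aw ?mem_head // scalerDr opprD addrACA subrr add0r.
      rewrite scaler_sumr -sumrB; apply: eq_big_seq => l ls.
      by rewrite Aw ?inE ?ls ?orbT // scalerBl.
    by rewrite memvB ?UA ?memvZ.
  by move=> l ls; rewrite -(scalerK (lk l ls) (w l)) memvZ ?wk.
move=> l; rewrite inE => /predU1P[->|]; last exact: wU.
rewrite -(addrK (\sum_(l <- s) w l) (w k)) memvB // big_seq memv_suml //.
Qed.

(** Apply [eigen_components] to the zero subspace. *)
Lemma eigen_free s w : uniq s ->
    {in s, forall l, A (w l) = l *: w l} -> {in s, forall l, w l != 0} ->
  free [seq w l | l <- s].
Proof.
move=> us Aw w0; rewrite -[map _ _]/(val (in_tuple (map w s))).
have sz : size (map w s) = size s by rewrite size_map.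
apply/freeP => k k0 i.
(* The coefficient k i, reindexed by eigenvalues; s has no repetitions. *)
pose c l := oapp k 0 (insub (index l s)).
have cE (j : 'I_(size (map w s))) : c s`_j = k j.
  by rewrite /c index_uniq ?valK // -sz.
have : {in s, forall l, c l *: w l \in 0%VS}.
  apply: eigen_components => // [l ls|u|].
  - by rewrite linearZ /= Aw // !scalerA mulrC.
  - by rewrite !memv0 => /eqP ->; rewrite linear0.
  - rewrite memv0 (big_nth 0) big_mkord -sz -[X in _ == X]k0; apply/eqP.
    by apply: eq_bigr => j _; rewrite cE (nth_map 0) // -sz.
move=> /(_ s`_i); rewrite mem_nth -?sz // memv0 cE scaler_eq0 => /(_ isT).
by case/orP => [/eqP //|]; rewrite (negPf (w0 _ _)) // mem_nth -?sz.
Qed.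

Lemma eigen_dim_span s w : uniq s ->
    {in s, forall l, A (w l) = l *: w l} -> {in s, forall l, w l != 0} ->
  \dim <<[seq w l | l <- s]>> = size s.
Proof. by move=> us Aw w0; rewrite (eqP (eigen_free us Aw w0)) size_map. Qed.

Lemma eigen_span_stable s w : {in s, forall l, A (w l) = l *: w l} ->
  {in <<[seq w l | l <- s]>>%VS, forall u, A u \in <<[seq w l | l <- s]>>%VS}.
Proof.
move=> Aw u; suff /subvP h : (<<[seq w l | l <- s]>> <=
    linfun A @^-1: <<[seq w l | l <- s]>>)%VS.
  by move=> /h; rewrite -memv_preim lfunE.
apply/span_subvP => _ /mapP[l ls ->].
by rewrite -memv_preim lfunE /= Aw // memvZ // memv_span ?map_f.
Qed.

Lemma eigen_span_min U s w : uniq s ->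
    {in s, forall l, A (w l) = l *: w l} ->
    {in U, forall u, A u \in U} -> \sum_(l <- s) w l \in U ->
  (<<[seq w l | l <- s]>> <= U)%VS.
Proof.
move=> us Aw UA sU; apply/span_subvP => _ /mapP[l ls ->].
exact: eigen_components Aw UA sU l ls.
Qed.

(** Apply [eigen_components] to the line of u: all components of u are on that
    line, so a nonzero one has the eigenvalue of u. *)
Lemma eigen_span_eigenvector s w k u : uniq s ->
    {in s, forall l, A (w l) = l *: w l} -> {in s, forall l, w l != 0} ->
    u \in <<[seq w l | l <- s]>>%VS -> u != 0 -> A u = k *: u ->
  k \in s /\ w k \in <[u]>%VS.
Proof.
move=> us Aw w0 + u0 Au; rewrite -[map _ _]/(val (in_tuple (map w s))) => /coord_span.
set X := in_tuple _; have sz : size (map w s) = size s by rewrite size_map.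
(* The coordinates of u, reindexed by eigenvalues; s has no repetitions. *)
pose c l := oapp (fun i => coord X i u) 0 (insub (index l s)).
have cE (j : 'I_(size (map w s))) : c s`_j = coord X j u.
  by rewrite /c index_uniq ?valK // -sz.
move=> uE; have {}uE : u = \sum_(l <- s) c l *: w l.
  rewrite [LHS]uE (big_nth 0) big_mkord -sz; apply: eq_bigr => j _.
  by rewrite cE (nth_map 0) // -sz.
have cw : {in s, forall l, c l *: w l \in <[u]>%VS}.
  apply: eigen_components => // [l ls|_ /vlineP[b ->]|].
  - by rewrite linearZ /= Aw // !scalerA mulrC.
  - by rewrite linearZ /= Au !memvZ ?memv_line.
  - by rewrite -uE memv_line.
have /hasP[l ls cl0] : has (fun l => c l != 0) s.
  apply: contraNT u0 => /hasPn c0; rewrite uE big_seq big1 // => l /c0.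
  by move=> /negPn/eqP ->; rewrite scale0r.
have wu : w l \in <[u]>%VS by rewrite -(scalerK cl0 (w l)) memvZ ?cw.
have /vlineP[b wb] := wu.
have : (k - l) *: w l = 0.
  by rewrite scalerBl -Aw // wb [A _]linearZ /= Au !scalerA mulrC subrr.
move/eqP; rewrite scaler_eq0 (negPf (w0 _ ls)) orbF subr_eq0 => /eqP kl.
by rewrite kl.
Qed.

End EigenFamilies.

Section AdjacencyOperator.
Set Implicit Arguments.
Unset Strict Implicit.
Import Order.TTheory GRing.Theory Num.Theory.
Local Open Scope ring_scope.
Variables (R : realType) (V : finType) (g : rel V).

(** Functions on the vertices avoid the numbering of the vertices by ordinals
    that matrices require; this matters for Cartesian powers, where functions
    are products over the coordinates. *)
Definition adjop (f : {ffun V -> R^o}) : {ffun V -> R^o} :=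
  [ffun x => \sum_(y | g x y) f y].

Lemma adjop_linear : linear adjop.
Proof.
move=> c f h; apply/ffunP => x; rewrite !ffunE scaler_sumr -big_split /=.
by apply: eq_bigr => y _; rewrite !ffunE.
Qed.

HB.instance Definition _ :=
  GRing.isLinear.Build R {ffun V -> R^o} {ffun V -> R^o} *:%R adjop adjop_linear.

Definition dfun (a : V) : {ffun V -> R^o} := [ffun x => (x == a)%:R].

Lemma dfun_decomp (f : {ffun V -> R^o}) : f = \sum_a f a *: dfun a.
Proof.
apply/ffunP => x; rewrite sum_ffunE (bigD1 x) //= !ffunE eqxx big1 ?addr0.
  by rewrite /GRing.scale /= mulr1.
by move=> y yx; rewrite !ffunE eq_sym (negPf yx) scaler0.
Qed.

Hypothesis g_sym : symmetric g.

Lemma adjmx_sym : (adjmx R g)^T = adjmx R g.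
Proof. by apply/matrixP => i j; rewrite !mxE g_sym. Qed.

Lemma mul_adjmx (v : 'rV[R]_#|V|) x :
  (v *m adjmx R g) ord0 (enum_rank x) = \sum_(y | g x y) v ord0 (enum_rank y).
Proof.
rewrite mxE (reindex enum_rank (onW_bij _ (enum_rank_bij V))) /=.
rewrite [RHS]big_mkcond; apply: eq_bigr => y _; rewrite !mxE !enum_rankK g_sym.
by case: (g x y); rewrite ?mulr1 ?mulr0.
Qed.

(** Positivity at r comes from w_l(r) = <e_r, w_l> = |w_l|^2. *)
Lemma local_spectral_decomp (r : V) :
  exists (s : seq R) (w : R -> {ffun V -> R^o}),
  [/\ uniq s, forall l, local_support R g r l <-> l \in s,
      forall l, adjop (w l) = l *: w l,
      {in s, forall l, 0 < w l r} & dfun r = \sum_(l <- s) w l].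
Proof.
pose d := delta_mx 0 (enum_rank r) : 'rV[R]_#|V|.
have [s [us sE ds]] := symmx_spectral_decomp d adjmx_sym.
pose p l := d *m orthproj (eigenspace (adjmx R g) l).
exists s, (fun l => [ffun x => p l ord0 (enum_rank x)]); split=> //.
- by move=> l; rewrite sE.
- move=> l; apply/ffunP => x; rewrite !ffunE.
  have /eigenspaceP/rowP/(_ (enum_rank x)) :
    (p l <= eigenspace (adjmx R g) l)%MS by exact: orthproj_sub.
  rewrite mul_adjmx mxE => e; rewrite [RHS](_ : _ = l * p l ord0 (enum_rank x)) // -e.
  by apply: eq_bigr => y _; rewrite ffunE.
- move=> l; rewrite sE -/(p l) => p0; rewrite ffunE.
  have -> : p l ord0 (enum_rank r) = (p l *m (p l)^T) ord0 ord0.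
    have -> : p l *m (p l)^T = d *m (p l)^T.
      apply/esym/eqP; rewrite -subr_eq0 -mulmxBl.
      have /submxP[D {2}->] : (p l <= eigenspace (adjmx R g) l)%MS by exact: orthproj_sub.
      by rewrite trmx_mul mulmxA orthproj_compl mul0mx.
    by rewrite -rowE !mxE.
  by rewrite lt_def sq_eq0 p0 sq_ge0.
- apply/ffunP => x; rewrite sum_ffunE ffunE.
  have /rowP/(_ (enum_rank x)) := ds.
  rewrite summxE mxE /= (inj_eq enum_rank_inj) => ->.
  by apply: eq_bigr => l _; rewrite ffunE.
Qed.

End AdjacencyOperator.

(** * Functions of the distance to the root *)

Section Distance.
Set Implicit Arguments.
Unset Strict Implicit.
Variables (T : finType) (e : rel T).

Lemma walk_gdist x p : path e x p -> gdist e x (last x p) <= size p.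
Proof.
move=> xp; rewrite /gdist; set P := fun k : nat => [exists _, _].
have [pT|Tp] := ltnP (size p) #|T|; last first.
  by apply: leq_trans Tp; apply: leq_trans (find_size _ _) _; rewrite size_iota.
rewrite leqNgt; apply/negP => lt; have /negP[] := negbT (before_find 0 lt).
rewrite nth_iota ?add0n //; apply/existsP.
by exists (in_tuple p); rewrite /= xp eqxx.
Qed.

Hypothesis e_conn : connected_graph e.

Lemma gdist_walk x y :
  exists p, [/\ path e x p, last x p = y & size p = gdist e x y].
Proof.
have /connectP[p0 xp0 yE] := e_conn x y; move: yE.
have [p xp up _ yp] := shortenP xp0.
have pT : size p < #|T| by have := uniq_leq_size up (fun z _ => mem_enum T z); rewrite -cardE.
set P := fun k : nat => [exists p : k.-tuple T, path e x p && (last x p == y)].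
have hP : has P (iota 0 #|T|).
  apply/hasP; exists (size p); first by rewrite mem_iota.
  by apply/existsP; exists (in_tuple p); rewrite /= xp yp eqxx.
have := nth_find 0 hP; rewrite nth_iota; last by rewrite -[X in _ < X](size_iota 0) -has_find.
rewrite add0n => /existsP[q /andP[xq /eqP yq]].
by exists q; split=> //; rewrite size_tuple.
Qed.

Lemma gdist_eq0 x y : (gdist e x y == 0) = (y == x).
Proof.
apply/eqP/eqP => [d0|->]; last by apply/eqP; rewrite -leqn0; exact: (@walk_gdist x [::]).
by have [p [_ yE]] := gdist_walk x y; rewrite d0 => /size0nil p0; rewrite -yE p0.
Qed.

Lemma gdist_step x y z : e y z -> gdist e x z <= (gdist e x y).+1.
Proof.
move=> yz; have [p [xp yE <-]] := gdist_walk x y.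
rewrite -(size_rcons p z); have := @walk_gdist x (rcons p z).
by rewrite last_rcons rcons_path yE; apply; rewrite xp.
Qed.

Lemma gdist_prev x z j : gdist e x z = j.+1 -> exists2 y, e y z & gdist e x y = j.
Proof.
move=> dz; have [p [xp]] := gdist_walk x z; rewrite dz.
case/lastP: p xp => // p t; rewrite rcons_path last_rcons size_rcons => /andP[xp pt] tz [sp].
rewrite {t}tz in pt; exists (last x p) => //; apply/eqP; rewrite eqn_leq.
by rewrite -{1}sp walk_gdist //= -ltnS -dz gdist_step.
Qed.

Lemma gdist_ecc x y : gdist e x y <= ecc e x.
Proof. exact: leq_bigmax. Qed.

Lemma sphere_nonempty x j : j <= ecc e x -> exists y, gdist e x y = j.
Proof.
have [y yE] : exists y, ecc e x = gdist e x y.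
  by have [|y yE] := @eq_bigmax T (gdist e x); [apply/card_gt0P; exists x | exists y].
suff walk d : forall y, gdist e x y = d -> j <= d -> exists y, gdist e x y = j.
  by rewrite yE; exact: walk.
elim: d => [|d IH] {yE}y dy.
  by rewrite leqn0 => /eqP ->; exists y.
rewrite leq_eqVlt => /predU1P[->|]; first by exists y.
by have [z _ /IH] := gdist_prev dy.
Qed.

End Distance.

Section SphereFunctions.
Set Implicit Arguments.
Unset Strict Implicit.
Import Order.TTheory GRing.Theory Num.Theory.
Local Open Scope ring_scope.
Variables (R : realType) (T : finType) (e : rel T) (r : T).
Hypotheses (e_conn : connected_graph e) (e_sym : symmetric e).
Hypothesis e_eqt : equitable e (distance_partition e r).

Local Notation D := (ecc e r).

Definition sphere_const (f : {ffun T -> R^o}) :=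
  forall x y, gdist e r x = gdist e r y -> f x = f y.

Definition sphere_ind j : {ffun T -> R^o} := [ffun x => (gdist e r x == j)%:R].

Definition sphere_space := <<[seq sphere_ind j | j <- iota 0 D.+1]>>%VS.

Lemma sphere_const_decomp f : sphere_const f ->
  exists c : nat -> R, f = \sum_(0 <= i < D.+1) c i *: sphere_ind i /\
    forall x, f x = c (gdist e r x).
Proof.
move=> fc; pose c i := f (odflt r [pick y | gdist e r y == i]).
have cE x : f x = c (gdist e r x).
  by rewrite /c; case: pickP => [y /eqP/esym/fc //|/(_ x)]; rewrite eqxx.
exists c; split=> //; apply/ffunP => x; rewrite sum_ffunE.
rewrite big_mkord (bigD1 (Ordinal (gdist_ecc e r x : (gdist e r x < D.+1)%N))) //=.
rewrite !ffunE eqxx big1 ?addr0 ?cE; first by rewrite /GRing.scale /= mulr1.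
by move=> i ix; rewrite !ffunE; case: eqP => [xi|_]; [case/eqP: ix; exact: val_inj|rewrite scaler0].
Qed.

Lemma mem_sphere_space f : f \in sphere_space <-> sphere_const f.
Proof.
split=> [|/sphere_const_decomp[c [-> _]]]; last first.
  rewrite big_seq memv_suml // => i; rewrite mem_index_iota => /andP[_ iD].
  by rewrite memvZ // memv_span // map_f // mem_iota.
rewrite /sphere_space -[map _ _]/(val (in_tuple [seq sphere_ind j | j <- iota 0 D.+1])).
move=> /coord_span -> x y xy; rewrite !sum_ffunE; apply: eq_bigr => i _.
rewrite [LHS]ffunE [RHS]ffunE (nth_map 0%N) ?ffunE ?xy //.
by apply: leq_trans (ltn_ord i) _; rewrite size_map.
Qed.

Lemma dim_sphere_space : \dim sphere_space = D.+1.
Proof.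
suff /eqP -> : free [seq sphere_ind j | j <- iota 0 D.+1] by rewrite size_map size_iota.
rewrite -[map _ _]/(val (in_tuple [seq sphere_ind j | j <- iota 0 D.+1])).
set X := in_tuple _.
have sz : size [seq sphere_ind j | j <- iota 0 D.+1] = D.+1 by rewrite size_map size_iota.
have XE (j : 'I_(size [seq sphere_ind j | j <- iota 0 D.+1])) : X`_j = sphere_ind j.
  have jD : (j < D.+1)%N by apply: leq_trans (ltn_ord j) _; rewrite sz.
  by rewrite (nth_map 0%N) ?size_iota // nth_iota.
apply/freeP => k k0 i.
have [y yi] : exists y, gdist e r y = i.
  by apply: sphere_nonempty => //; rewrite -ltnS; apply: leq_trans (ltn_ord i) _; rewrite sz.
have /ffunP/(_ y) := k0; rewrite sum_ffunE (bigD1 i) //= XE.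
rewrite !ffunE yi eqxx big1 ?addr0 => [|j ji].
  by rewrite /GRing.scale /= mulr1.
by rewrite XE !ffunE yi eq_sym (inj_eq val_inj) (negPf ji) scaler0.
Qed.

Lemma adjop_sphere_ind j x :
  adjop e (sphere_ind j) x = #|(nbhd e x :&: sphere e r j)%SET|%:R.
Proof.
rewrite ffunE -sum1_card natr_sum [LHS]big_mkcond [RHS]big_mkcond /=.
apply: eq_bigr => y _; rewrite !inE ffunE.
by case: (e x y) => //=; case: eqP.
Qed.

Lemma adjop_sphere_const f : sphere_const f -> sphere_const (adjop e f).
Proof.
move=> /sphere_const_decomp[c [-> _]] x y xy.
rewrite linear_sum /= !sum_ffunE big_seq [RHS]big_seq; apply: eq_bigr => i.
rewrite mem_index_iota => /andP[_ iD]; rewrite linearZ /= [LHS]ffunE [RHS]ffunE.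
congr (_ *: _); rewrite !adjop_sphere_ind; congr (_%:R).
have dp (j : nat) : (j < D.+1)%N -> sphere e r j \in distance_partition e r.
  by move=> jD; apply/imsetP; exists (Ordinal jD).
apply: (e_eqt (dp _ (gdist_ecc e r x : (_ < D.+1)%N)) (dp _ iD)).
  by rewrite inE.
by rewrite inE xy.
Qed.

(** By equitability, A maps the indicator of the n-th sphere to a combination of
    indicators. Spheres beyond the (n+1)-th do not occur in it, and the
    coefficient of the (n+1)-th is nonzero, so that this sphere is obtained from
    the earlier ones. *)
Lemma sphere_ind_generated (U : {vspace {ffun T -> R^o}}) :
    {in U, forall u, adjop e u \in U} -> dfun R r \in U ->
  forall j, (j <= D)%N -> sphere_ind j \in U.
Proof.
move=> UA U0 j; elim: j {-2}j (leqnn j) => [|n IH] j.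
  rewrite leqn0 => /eqP -> _; suff -> : sphere_ind 0 = dfun R r by [].
  by apply/ffunP => x; rewrite !ffunE gdist_eq0.
rewrite leq_eqVlt => /predU1P[->{j}|]; last exact: IH.
move=> nD; have nU := IH n (leqnn n) (ltnW nD).
have indc : sphere_const (sphere_ind n) by move=> x y xy; rewrite !ffunE xy.
have [c [cE cv]] := sphere_const_decomp (adjop_sphere_const indc).
have c0 i : (n.+1 < i <= D)%N -> c i = 0.
  move=> /andP[ni iD]; have [y yi] := sphere_nonempty e_conn iD.
  rewrite -yi -cv adjop_sphere_ind; apply/eqP; rewrite pnatr_eq0 cards_eq0.
  apply/eqP/setP => z; rewrite !inE; apply/negP => /andP[yz /eqP zn].
  have := gdist_step e_conn r (z := y) (y := z); rewrite e_sym yi zn => /(_ yz).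
  by rewrite leqNgt ni.
have cn : c n.+1 != 0.
  have [y yn] := sphere_nonempty e_conn nD.
  rewrite -yn -cv adjop_sphere_ind pnatr_eq0 cards_eq0; apply/set0Pn.
  by have [z zy zn] := gdist_prev e_conn yn; exists z; rewrite !inE e_sym zy zn eqxx.
rewrite -(scalerK cn (sphere_ind n.+1)) memvZ //.
have -> : c n.+1 *: sphere_ind n.+1 =
  adjop e (sphere_ind n) - \sum_(0 <= i < n.+1) c i *: sphere_ind i.
  rewrite cE (big_cat_nat (n := n.+1)) //= 1?ltnW // addrAC subrr add0r.
  rewrite big_ltn // big_nat big1 ?addr0 // => i /andP[ni iD].
  by rewrite c0 ?scale0r // ni.
rewrite memvB ?UA // big_seq memv_suml // => i; rewrite mem_index_iota => /andP[_ ni].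
by rewrite memvZ // IH //; exact: leq_trans (ltnW nD).
Qed.

End SphereFunctions.

Section LocalSupport.
Set Implicit Arguments.
Unset Strict Implicit.
Import Order.TTheory GRing.Theory Num.Theory.
Local Open Scope ring_scope.
Variables (R : realType) (T : finType) (e : rel T) (r : T) (k : nat).
Hypotheses (e_conn : connected_graph e) (e_sym : symmetric e).
Hypothesis e_reg : forall x, #|nbhd e x| = k.
Hypothesis e_eqt : equitable e (distance_partition e r).
Local Notation D := (ecc e r).

Lemma adjop_const1 : adjop e [ffun=> 1] = k%:R *: [ffun=> 1] :> {ffun T -> R^o}.
Proof.
apply/ffunP => x; rewrite !ffunE [RHS]mulr1 -(e_reg x) -sum1_card natr_sum.
by apply: eq_big => y; rewrite ?inE // ffunE.
Qed.

(** Evaluate the eigenvalue equation where the eigenfunction is largest in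
    absolute value. *)
Lemma eigenvalue_le_degree (f : {ffun T -> R^o}) l :
  adjop e f = l *: f -> f != 0 -> l <= k%:R.
Proof.
move=> Af f0.
have [x0 fx0] : exists x, f x != 0.
  apply/existsP; apply: contraNT f0 => /existsPn f0; apply/eqP/ffunP => x.
  by rewrite ffunE; apply/eqP; have := f0 x; rewrite negbK.
have [x _ xmax] := arg_maxP (fun x : T => `|f x : R|) (isT : xpredT x0).
have fx : 0 < `|f x| :> R by apply: lt_le_trans (xmax x0 isT); rewrite normr_gt0.
rewrite -(ler_pM2r fx); apply: le_trans (_ : `|l * f x| <= _).
  by rewrite normrM ler_wpM2r // ler_norm.
have /ffunP/(_ x) := Af; rewrite !ffunE => Afx; rewrite -[l * _]Afx.
apply: le_trans (ler_norm_sum _ _ _) _.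
apply: le_trans (_ : \sum_(y | e x y) `|f x : R| <= _).
  by apply: ler_sum => y _; exact: xmax.
rewrite sumr_const -[X in X%:R * _](e_reg x) mulr_natl.
by rewrite (eq_card (B := mem (nbhd e x))) // => y; rewrite !inE.
Qed.

(** The span of the components of e_r is the smallest A-stable space containing
    e_r, which is the space of functions of the distance to r. Comparing
    dimensions gives the size of the support; the constant function is in the
    span, so it is proportional to the component of its eigenvalue k. *)
Lemma local_support_structure :
  exists (s : seq R) (w : R -> {ffun T -> R^o}),
  [/\ uniq s, forall l, local_support R e r l <-> l \in s,
      size s = D.+1 &
   [/\ forall l, adjop e (w l) = l *: w l,
      {in s, forall l, 0 < w l r}, dfun R r = \sum_(l <- s) w l,
      {in s, forall l, sphere_const e r (w l)} &
      [/\ k%:R \in s, forall x, w k%:R x = w k%:R r & {in s, forall l, l <= k%:R}]]].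
Proof.
have [s [w [us sE Aw w_gt0 dE]]] := local_spectral_decomp R e_sym r.
have w0 : {in s, forall l, w l != 0}.
  by move=> l /w_gt0; apply: contraTneq => ->; rewrite ffunE ltxx.
have Aws : {in s, forall l, adjop e (w l) = l *: w l} by move=> l _; exact: Aw.
have spE : <<[seq w l | l <- s]>>%VS = sphere_space R e r.
  apply/eqP; rewrite eqEsubv; apply/andP; split.
    apply: (eigen_span_min (A := adjop e)) => //.
    - move=> u /mem_sphere_space uc; apply/mem_sphere_space.
      exact: adjop_sphere_const.
    - rewrite -dE; apply/mem_sphere_space => x y xy.
      by rewrite !ffunE -!(gdist_eq0 e_conn) xy.
  apply/span_subvP => _ /mapP[j + ->]; rewrite mem_iota => /= jD.
  apply: sphere_ind_generated => //.
    by apply: (eigen_span_stable (A := adjop e)).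
  by rewrite dE big_seq memv_suml // => l ls; rewrite memv_span ?map_f.
exists s, w; split=> //.
  by rewrite -(eigen_dim_span (A := adjop e) us Aws w0) // spE dim_sphere_space.
have one0 : [ffun=> 1] != 0 :> {ffun T -> R^o}.
  by apply/eqP => /ffunP/(_ r)/eqP; rewrite !ffunE oner_eq0.
have one_sp : [ffun=> 1] \in <<[seq w l | l <- s]>>%VS.
  by rewrite spE; apply/mem_sphere_space => x y _; rewrite !ffunE.
have [ks /vlineP[b wk]] :=
  eigen_span_eigenvector (A := adjop e) us Aws w0 one_sp one0 adjop_const1.
split=> //.
  by move=> l ls; apply/mem_sphere_space; rewrite -spE memv_span ?map_f.
split=> // [x|l ls]; first by rewrite wk !ffunE.
exact: eigenvalue_le_degree (Aw l) (w0 l ls).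
Qed.

End LocalSupport.

(** * Distance-regular graphs *)

Section DistanceRegular.
Set Implicit Arguments.
Unset Strict Implicit.
Import Order.TTheory GRing.Theory Num.Theory.
Local Open Scope ring_scope.
Variables (R : realType) (T : finType) (e : rel T) (k : nat) (b c : nat -> nat).
Hypotheses (e_conn : connected_graph e) (e_sym : symmetric e).
Hypothesis e_reg : forall x, #|nbhd e x| = k.
Hypothesis e_dreg : forall x y,
  #|[set z in nbhd e y | gdist e x z == (gdist e x y).+1]%SET| = b (gdist e x y) /\
  #|[set z in nbhd e y | (gdist e x z).+1 == gdist e x y]%SET| = c (gdist e x y).

(** For j < ecc x, a geodesic from x shows that b_j is positive, so a vertex at
    distance j from y has a neighbour at distance j + 1. *)
Lemma leq_ecc x y j : (j <= ecc e x)%N -> (j <= ecc e y)%N.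
Proof.
elim: j => // j IH jx; have [x' x'j] := sphere_nonempty e_conn jx.
have [x1 x1x' x1j] := gdist_prev e_conn x'j.
have [y1 y1j] := sphere_nonempty e_conn (IH (ltnW jx)).
have [bx _] := e_dreg x x1; have [by_ _] := e_dreg y y1.
have : (0 < b j)%N.
  by rewrite -x1j -bx; apply/card_gt0P; exists x'; rewrite !inE x1x' x'j x1j eqxx.
rewrite -{1}y1j -by_ => /card_gt0P[z]; rewrite !inE y1j => /andP[_ /eqP <-].
exact: gdist_ecc.
Qed.

Lemma ecc_diam x : ecc e x = diam e.
Proof.
apply/eqP; rewrite eqn_leq leq_bigmax /=; apply/bigmax_leqP => y _.
exact: leq_ecc (leqnn _).
Qed.

Definition radial x (phi : nat -> R) : {ffun T -> R^o} := [ffun y => phi (gdist e x y)].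

Definition radial_adj (phi : nat -> R) j : R :=
  (b j)%:R * phi j.+1 + (c j)%:R * phi j.-1 + (k%:R - (b j)%:R - (c j)%:R) * phi j.

(** The point is that [radial_adj] does not depend on x: the adjacency operator
    acts in the same way on functions of the distance to any vertex. *)
Lemma adjop_radial x phi : adjop e (radial x phi) = radial x (radial_adj phi).
Proof.
apply/ffunP => y; rewrite !ffunE /radial_adj; have [<- <-] := e_dreg x y.
rewrite -(e_reg y); set j := gdist e x y.
set N1 := [set z in nbhd e y | gdist e x z == j.+1]%SET.
set N2 := [set z in nbhd e y | (gdist e x z).+1 == j]%SET.
have sumE (N : {set T}) d : {in N, forall z, gdist e x z = d} ->
    \sum_(z in N) phi (gdist e x z) = #|N|%:R * phi d.
  move=> Nd; rewrite (eq_bigr (fun=> phi d)); first by rewrite sumr_const mulr_natl.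
  by move=> z /Nd ->.
pose N3 := (nbhd e y :\: (N1 :|: N2))%SET.
have N12 : [disjoint N1 & N2].
  rewrite -setI_eq0; apply/eqP/setP => z; rewrite !inE; apply/negP.
  by move=> /andP[/andP[_ /eqP ->] /andP[_ /eqP]]; lia.
have N3E : #|nbhd e y|%:R - #|N1|%:R - #|N2|%:R = #|N3|%:R :> R.
  have -> : #|nbhd e y| = (#|N1| + #|N2| + #|N3|)%N.
    rewrite -(cardsID (N1 :|: N2) (nbhd e y)); congr (_ + _)%N.
    rewrite -cardsUI (disjoint_setI0 N12) cards0 addn0; apply: eq_card => z.
    by rewrite !inE; case: (e y z); rewrite ?andbF.
  by rewrite !natrD; lra.
rewrite N3E -(sumE N1) => [|z]; last by rewrite !inE => /andP[_ /eqP].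
rewrite -(sumE N2) => [|z]; last by rewrite !inE => /andP[_ /eqP <-].
rewrite -(sumE N3) => [|z]; last first.
  rewrite !inE negb_or => /andP[/andP[+ +] yz]; rewrite yz /= => z1 z2.
  have := gdist_step e_conn x yz; rewrite e_sym in yz.
  have := gdist_step e_conn x yz; rewrite -/j; move: z1 z2; lia.
rewrite (eq_bigr (fun z => phi (gdist e x z))); last by move=> z _; rewrite ffunE.
rewrite -bigU //=; transitivity (\sum_(z in nbhd e y) phi (gdist e x z)).
  by apply: eq_bigl => z; rewrite inE.
rewrite (big_setID (N1 :|: N2)) /=; congr (_ + _).
by apply: eq_bigl => z; rewrite !inE; case: (e y z); rewrite ?andbF.
Qed.

(** The operator p(A) f for p the product of the X - l, l in s. *)
Definition adjprod s (f : {ffun T -> R^o}) :=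
  foldr (fun l h => adjop e h - l *: h) f s.

Lemma adjprod_linear s : linear (adjprod s).
Proof.
move=> a f h; elim: s => //= l s ->.
by rewrite linearP /= scalerDr !scalerA mulrC -scalerA opprD addrACA scalerBr.
Qed.
HB.instance Definition _ s := GRing.isLinear.Build R {ffun T -> R^o} {ffun T -> R^o}
  *:%R (adjprod s) (adjprod_linear s).

Lemma adjprod_eigen s f l : adjop e f = l *: f ->
  adjprod s f = (\prod_(x <- s) (l - x)) *: f.
Proof.
move=> Af; elim: s => [|x s IH] /=; first by rewrite big_nil scale1r.
rewrite IH linearZ /= Af big_cons !scalerA -scalerBl; congr (_ *: _).
by rewrite mulrBl mulrC.
Qed.

Lemma adjprod_radial s : exists L : (nat -> R) -> nat -> R,
  forall x phi, adjprod s (radial x phi) = radial x (L phi).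
Proof.
elim: s => [|l s [L LE]]; first by exists id.
exists (fun phi j => radial_adj (L phi) j - l * L phi j) => x phi /=.
by rewrite LE adjop_radial; apply/ffunP => y; rewrite !ffunE.
Qed.

(** The values of p(A) e_x are those of one function of the distance to x, the
    same for all x. If p(A) e_r = 0, this function vanishes up to the
    eccentricity of r, which is the diameter; hence p(A) = 0 and every
    eigenvalue is a root of p. *)
Lemma annihilating_base_eigenvalue s r (f : {ffun T -> R^o}) l :
  adjprod s (dfun R r) = 0 -> adjop e f = l *: f -> f != 0 -> l \in s.
Proof.
move=> s0 Af f0; have [L LE] := adjprod_radial s.
have dE x : dfun R x = radial x (fun j => (j == 0%N)%:R).
  by apply/ffunP => y; rewrite !ffunE gdist_eq0.
have sx x : adjprod s (dfun R x) = 0.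
  apply/ffunP => y; rewrite dE LE !ffunE.
  have [z zd] : exists z, gdist e r z = gdist e x y.
    by apply: sphere_nonempty => //; rewrite ecc_diam -(ecc_diam x) gdist_ecc.
  by rewrite -zd; have /ffunP/(_ z) := s0; rewrite dE LE !ffunE.
have : adjprod s f = 0.
  by rewrite (dfun_decomp f) linear_sum big1 // => a _; rewrite linearZ /= sx scaler0.
rewrite (adjprod_eigen _ Af) => /eqP; rewrite scaler_eq0 (negPf f0) orbF.
by rewrite prodf_seq_eq0 => /hasP[x xs /= ]; rewrite subr_eq0 => /eqP ->.
Qed.

End DistanceRegular.

Section DistanceRegularSpectrum.
Set Implicit Arguments.
Unset Strict Implicit.
Import Order.TTheory GRing.Theory Num.Theory.
Local Open Scope ring_scope.

Lemma distance_regular_support (R : realType) (T : finType) (e : rel T) (r : T) k :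
    symmetric e -> (forall x, #|nbhd e x| = k) -> distance_regular e ->
  ecc e r = diam e /\ local_support R e r = spectrum R e.
Proof.
move=> e_sym e_reg [e_conn [b [c e_dreg]]]; split; first exact: ecc_diam e_dreg _.
have [s [w [us sE Aw w_gt0 dE]]] := local_spectral_decomp R e_sym r.
apply/seteqP; split=> l.
  rewrite /local_support /spectrum /= => l0; apply/eigenvalueP.
  exists (delta_mx 0 (enum_rank r) *m orthproj (eigenspace (adjmx R e) l)) => //.
  by apply/eigenspaceP; exact: orthproj_sub.
rewrite /spectrum /= => /eigenvalueP[v /rowP vE v0].
pose f : {ffun T -> R^o} := [ffun x => v ord0 (enum_rank x)].
apply/sE; apply: (annihilating_base_eigenvalue (f := f) e_conn e_sym e_reg e_dreg (r := r)).
- rewrite dE linear_sum /= big_seq big1 // => x xs.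
  rewrite (adjprod_eigen _ (Aw x)) (_ : \prod_(_ <- _) _ = 0) ?scale0r //.
  by apply/eqP; rewrite prodf_seq_eq0; apply/hasP; exists x => //=; rewrite subrr.
- apply/ffunP => x; have := vE (enum_rank x); rewrite mul_adjmx // mxE !ffunE => vx.
  rewrite [RHS](_ : _ = l * v ord0 (enum_rank x)) // -vx.
  by apply: eq_bigr => y _; rewrite ffunE.
- apply: contraNneq v0 => f0; apply/eqP/rowP => i; rewrite mxE.
  by have /ffunP/(_ (enum_val i)) := f0; rewrite !ffunE enum_valK.
Qed.

End DistanceRegularSpectrum.

(** * Sumsets of finite sets of reals *)

Section Sumsets.
Set Implicit Arguments.
Unset Strict Implicit.
Import Order.TTheory GRing.Theory Num.Theory.
Local Open Scope ring_scope.
Variables (R : realType) (Theta : set R) (s : seq R) (D m : nat) (S : seq R).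
Hypotheses (s_uniq : uniq s) (sE : forall l, Theta l <-> l \in s).
Hypothesis size_s : size s = D.+1.
Hypotheses (S_uniq : uniq S) (SE : forall x, msumset m Theta x <-> x \in S).
Hypothesis m_gt0 : (0 < m)%N.

Let t i : R := (sort <=%R s)`_i.

Lemma sorted_support_lt i j : (i < j <= D)%N -> t i < t j.
Proof.
move=> /andP[ij jD]; have ss : sorted <%R (sort <=%R s).
  by rewrite sort_lt_sorted.
apply: (sorted_ltn_nth lt_trans 0 ss) => //; rewrite inE size_sort size_s //.
exact: ltn_trans ij _.
Qed.

Lemma sorted_supportP l : Theta l <-> exists2 i, (i <= D)%N & l = t i.
Proof.
rewrite sE -(mem_sort <=%R); split=> [/(nthP 0)[i]|[i iD ->]].
  by rewrite size_sort size_s => iD <-; exists i.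
by rewrite mem_nth // size_sort size_s.
Qed.

(** For n = q m + j with j < m, this is (m - j) t_q + j t_(q+1): from n to n + 1,
    one summand moves to the next larger element of Theta. *)
Definition sum_chain n : R := \sum_(j < m) t ((n + j) %/ m).

Lemma sum_chainS n : sum_chain n.+1 = sum_chain n + (t (n %/ m).+1 - t (n %/ m)).
Proof.
rewrite /sum_chain; have [p mE] : exists p, m = p.+1 by case: m m_gt0 => // p _; exists p.
have -> : (n %/ m).+1 = ((n + m) %/ m)%N by rewrite divnDr // divnn m_gt0 addn1.
rewrite {}mE big_ord_recr big_ord_recl /= addn0 addSnnS.
rewrite addrC [RHS]addrC -addrA; congr (_ + _); rewrite addrA addNr add0r.
by apply: eq_bigr => j _; rewrite addSnnS.
Qed.

Lemma sum_chain_lt n k : (n < k <= m * D)%N -> sum_chain n < sum_chain k.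
Proof.
move=> /andP[]; elim: k => // k IH; rewrite ltnS => nk kD.
have kS : sum_chain k < sum_chain k.+1.
  rewrite sum_chainS ltrDl subr_gt0 sorted_support_lt // ltnS leqnn /=.
  by rewrite ltn_divLR // mulnC.
move: nk; rewrite leq_eqVlt => /predU1P[->//|nk].
by apply: lt_trans kS; apply: IH => //; exact: ltnW.
Qed.

Lemma sum_chain_mem n : (n <= m * D)%N -> sum_chain n \in S.
Proof.
move=> nD; apply/SE; exists (fun j => t ((n + j) %/ m)) => //= j.
apply/sorted_supportP; exists ((n + j) %/ m)%N => //.
by rewrite -ltnS ltn_divLR //; have := ltn_ord j; lia.
Qed.

Lemma sum_chain_uniq : uniq [seq sum_chain n | n <- iota 0 (m * D).+1].
Proof.
rewrite map_inj_in_uniq ?iota_uniq // => i j; rewrite !mem_iota /= !add0n !ltnS => iD jD.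
case: (ltngtP i j) => // ij => [/eqP|/eqP]; first by rewrite lt_eqF // sum_chain_lt ?ij.
by rewrite gt_eqF // sum_chain_lt ?ij.
Qed.

Lemma sum_chain_sub : {subset [seq sum_chain n | n <- iota 0 (m * D).+1] <= S}.
Proof. by move=> _ /mapP[n + ->]; rewrite mem_iota => /= nD; exact: sum_chain_mem. Qed.

Lemma sumset_size_ge : (m * D < size S)%N.
Proof.
by have := uniq_leq_size sum_chain_uniq sum_chain_sub; rewrite size_map size_iota.
Qed.

(** In case of equality the chain exhausts the sumset. The element
    (m - 2) t_i + t_(i-1) + t_(i+1) lies strictly between the chain elements of
    index m i - 1 and m i + 1, so it equals the one between them, m t_i. *)
Lemma sumset_eq_second_difference i : (2 <= m)%N -> size S = (m * D).+1 ->
  (0 < i < D)%N -> t i.+1 - t i = t i - t i.-1.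
Proof.
move=> m2 szS /andP[i0 iD].
have memS : [seq sum_chain n | n <- iota 0 (m * D).+1] =i S.
  have [] // := uniq_min_size sum_chain_uniq sum_chain_sub.
  by rewrite szS size_map size_iota.
have [p mE] : exists p, m = p.+2 by case: m m2 => [|[|p]] // _; exists p.
have mi0 : (0 < m * i)%N by rewrite muln_gt0 m_gt0.
have miD : ((m * i).+1 <= m * D)%N by rewrite ltn_pmul2l.
pose q := (m * i).-1.
have qS : q.+1 = (m * i)%N by rewrite prednK.
have qm : (q %/ m = i.-1)%N.
  have -> : q = (m.-1 + i.-1 * m)%N.
    apply/succn_inj; rewrite qS -addSn prednK // mulnC.
    by rewrite -{1}(prednK i0) mulSn.
  by rewrite divnDMl // divn_small ?prednK // add0n.
have c1 : sum_chain (m * i) = sum_chain q + (t i - t i.-1).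
  by rewrite -qS sum_chainS qm prednK.
have c2 : sum_chain (m * i).+1 = sum_chain (m * i) + (t i.+1 - t i).
  by rewrite sum_chainS mulKn.
(* The chain element of index q = m i - 1 is (m - 1) t_i + t_(i-1); one of its
   summands t_i, the last one, is changed to t_(i+1). *)
pose x := sum_chain q + (t i.+1 - t i).
have : x \in S.
  apply/SE.
  exists (fun j : 'I_m => if j == m.-1 :> nat then t i.+1 else t ((q + j) %/ m)).
    move=> j; apply/sorted_supportP; case: ifP => _; first by exists i.+1.
    exists ((q + j) %/ m)%N => //.
    apply: leq_trans (_ : i <= D)%N; last exact: ltnW.
    by rewrite -ltnS ltn_divLR //; have := ltn_ord j; lia.
  rewrite /x /sum_chain; move: qS; move: (q) => q' qS.
  have lastE : ((q' + m.-1) %/ m = i)%N.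
    have -> : (q' + m.-1 = p + i * m)%N by lia.
    by rewrite divnDMl // divn_small ?mE // addn0.
  move: lastE; rewrite mE => lastE.
  rewrite big_ord_recr [in RHS]big_ord_recr /= eqxx lastE -addrA [t i + _]addrC subrK.
  by congr (_ + _); apply: eq_bigr => j _; rewrite ifF // ltn_eqF.
rewrite -memS => /mapP[n]; rewrite mem_iota add0n ltnS => /= nD xE.
have d1 : t i.-1 < t i by rewrite sorted_support_lt // (ltnW iD) prednK ?leqnn.
have d2 : t i < t i.+1 by rewrite sorted_support_lt // ltnS leqnn.
have nE : n = (m * i)%N.
  have nq : (q < n)%N.
    rewrite ltnNge leq_eqVlt; apply/negP => /predU1P[nq|nq].
      by move: xE; rewrite /x nq; lra.
    have := @sum_chain_lt n q; rewrite nq -xE => /(_ (ltnW (ltnW _))).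
    rewrite qS miD /x => /(_ isT).
    by lra.
  have nq' : (n < (m * i).+1)%N.
    rewrite ltnNge leq_eqVlt; apply/negP => /predU1P[nq'|nq'].
      by move: xE; rewrite -nq' c2 c1 /x; lra.
    have := @sum_chain_lt (m * i).+1 n; rewrite nq' nD -xE c2 c1 /x => /(_ isT).
    by lra.
  by lia.
by move: xE; rewrite nE c1 /x; lra.
Qed.

Lemma sumset_eq_arith_prog : (2 <= m)%N -> (1 <= D)%N -> size S = (m * D).+1 ->
  arith_prog Theta.
Proof.
move=> m2 D1 szS; pose d := t 1 - t 0.
have step i : (i < D)%N -> t i.+1 - t i = d.
  elim: i => // i IH iD.
  by rewrite (sumset_eq_second_difference (i := i.+1)) //= IH // ltnW.
have tE i : (i <= D)%N -> t i = t 0 + d *+ i.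
  elim: i => [|i IH] iD; first by rewrite mulr0n addr0.
  by rewrite mulrS addrCA -IH ?(ltnW iD) // -(step i iD) subrK.
exists (t 0), d, D.+1; split; first by rewrite subr_gt0 sorted_support_lt ?D1.
apply/seteqP; split=> l.
  by move=> /sorted_supportP[i iD ->]; exists i => //; rewrite -tE.
move=> [i /= iD <-]; apply/sorted_supportP. by exists i => //; rewrite -tE.
Qed.

Lemma arith_prog_sumset_size : arith_prog Theta -> (size S <= (m * D).+1)%N.
Proof.
move=> [c [d [k [d0 TE]]]].
pose f i := c + d *+ i.
have f_inj : injective f.
  by move=> i j /addrI; apply: mulrIn; rewrite gt_eqF.
have kD : (k <= D.+1)%N.
  rewrite -size_s -(size_iota 0 k) -(size_map f); apply: uniq_leq_size.
    by rewrite map_inj_uniq ?iota_uniq.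
  move=> _ /mapP[i + ->]; rewrite mem_iota /= => ik; apply/sE; rewrite TE.
  by exists i.
rewrite -(size_iota 0 (m * D).+1) -(size_map (fun i => c *+ m + d *+ i)).
apply: uniq_leq_size => // x /SE[u uT <-].
have /boolp.choice[n nP] : forall j, exists n, (n < k)%N /\ f n = u j.
  by move=> j; have := uT j; rewrite TE => -[n nk <-]; exists n.
apply/mapP; exists (\sum_(j < m) n j)%N.
  rewrite mem_iota /= add0n ltnS; apply: leq_trans (_ : \sum_(j < m) D <= _)%N.
    by apply: leq_sum => j _; rewrite -ltnS; apply: leq_trans kD; exact: (nP j).1.
  by rewrite sum_nat_const card_ord.
rewrite -sumrMnr -[m in c *+ m]card_ord -sumr_const -big_split /=.
by apply: eq_bigr => j _; rewrite -(nP j).2.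
Qed.

End Sumsets.

(** * Deleting a vertex *)

Section VertexDeletion.
Set Implicit Arguments.
Unset Strict Implicit.
Import Order.TTheory GRing.Theory Num.Theory.
Local Open Scope ring_scope.
Variables (R : realType) (V : finType) (g : rel V) (a : V) (K : R).
Hypothesis g_sym : symmetric g.

Local Notation W := {x : V | x != a}.
Local Notation B := (delB R g a).
Local Notation E := (delE R g a).
Local Notation one := (delone R a).
Local Notation dK := (delK R g a).
Local Notation F := {ffun V -> R^o}.

Definition restr (f : F) : 'cV[R]_#|{: W}| := \col_i f (val (enum_val i)).

Lemma restr_linear : linear restr.
Proof. by move=> c f h; apply/colP => i; rewrite !mxE !ffunE. Qed.
HB.instance Definition _ := GRing.isLinear.Build R F 'cV[R]_#|{: W}| *:%R restr restr_linear.

Lemma restr_dfun : restr (dfun R a) = 0.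
Proof. by apply/colP => i; rewrite !mxE ffunE (negPf (valP (enum_val i))). Qed.

Lemma restr_eq0 f : restr f = 0 -> f = f a *: dfun R a.
Proof.
move=> f0; apply/ffunP => x; rewrite !ffunE; have [->|xa] := eqVneq x a.
  by rewrite /GRing.scale /= mulr1.
rewrite scaler0; have /colP/(_ (enum_rank (Sub x xa : W))) := f0.
by rewrite !mxE enum_rankK SubK.
Qed.

Lemma delB_restr f : B *m restr f = restr (adjop g (f - f a *: dfun R a)).
Proof.
apply/colP => i; rewrite !mxE ffunE.
rewrite (reindex enum_rank (onW_bij _ (enum_rank_bij _))) /=.
rewrite [RHS](bigID (fun y => y == a)) /= [X in _ = X + _]big1 ?add0r; last first.
  by move=> y /andP[_ /eqP ->]; rewrite !ffunE eqxx /GRing.scale /= mulr1 subrr.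
pose x := val (enum_val i).
rewrite [RHS](eq_bigl (fun y => (y != a) && g x y)); last by move=> y; rewrite andbC.
rewrite big_mkcondr /= (reindex_omap (fun y : W => val y)
  (fun y => insub y : option W)) /=; last first.
  by move=> y ya; rewrite (insubT (fun y => y != a) ya).
apply: eq_big => [y|y _].
  by rewrite valK eqxx andbT (valP y : val y != a).
rewrite !mxE !enum_rankK /del_vertex /= -/x !ffunE.
rewrite (negPf (valP y : val y != a)) scaler0 subr0.
by case: (g x _); rewrite ?mul1r ?mul0r.
Qed.

Lemma delone_restr : one = restr [ffun=> 1].
Proof. by apply/colP => i; rewrite !mxE ffunE. Qed.

Lemma adjop_dfun x : adjop g (dfun R a) x = (g a x)%:R.
Proof.
rewrite ffunE big_mkcond (bigD1 a) //= big1 ?addr0; last first.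
  by move=> y ya; rewrite ffunE (negPf ya) if_same.
by rewrite ffunE eqxx g_sym; case: (g a x).
Qed.

Lemma delE_restr f i : (E *m restr f) i ord0 =
  (g a (val (enum_val i)))%:R * f (val (enum_val i)).
Proof. by rewrite mul_diag_mx !mxE. Qed.

Lemma delE_one : E *m one = restr (adjop g (dfun R a)).
Proof.
apply/colP => i; rewrite delone_restr delE_restr [RHS]mxE adjop_dfun.
by rewrite ffunE mulr1.
Qed.

Lemma mem_delK_pow k : B ^+ k *m one \in dK.
Proof. by apply/memv_vcap => U SU; apply: (SU (B ^+ k *m one)); exists k. Qed.

Lemma delK_min (U : {vspace 'cV[R]_#|{: W}|}) :
  (forall k, B ^+ k *m one \in U) -> (dK <= U)%VS.
Proof. by move=> BU; apply/subvP => v /memv_vcap; apply => _ [k _ <-]; exact: BU. Qed.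

Lemma delB_delK v : v \in dK -> B *m v \in dK.
Proof.
suff /subvP h : (dK <= linfun (mulmx B) @^-1: dK)%VS.
  by move=> /h; rewrite -memv_preim lfunE.
apply: delK_min => k; rewrite -memv_preim lfunE /= mulmxA.
have -> : B *m B ^+ k = B ^+ k.+1 by rewrite exprS.
exact: mem_delK_pow.
Qed.

(** The matrices that map the space R[B]1 to itself form a unital algebra
    containing B, and E by hypothesis. *)
Lemma delP_delK : {in dK, forall v, E *m v \in dK} -> delP R g a = dK.
Proof.
move=> EK; apply/eqP; rewrite eqEsubv; apply/andP; split; last first.
  apply: delK_min => k; apply/delPE; exists (B ^+ k) => //.
  apply/memv_vcap => U [[U1 UM] US].
  elim: k => [|k IH]; first by rewrite expr0.
  by rewrite exprS; apply: UM => //; apply: US; left.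
(* The matrices preserving R[B]1, as an intersection of preimages. *)
pose U := vcap [set U : {vspace 'M[R]_#|{: W}|} |
  exists2 x, x \in dK & U = (linfun (mulmxr x) @^-1: dK)%VS]%classic.
have UP X : X \in U <-> {in dK, forall x, X *m x \in dK}.
  split=> [/memv_vcap XU x xK|XK].
    have : X \in (linfun (mulmxr x) @^-1: dK)%VS by apply: XU; exists x.
    by rewrite -memv_preim lfunE.
  by apply/memv_vcap => _ [x xK ->]; rewrite -memv_preim lfunE /= XK.
apply/subvP => v /delPE[X XA ->].
have /UP : X \in U.
  move: X XA => X /memv_vcap; apply; split.
    split; first by apply/UP => x; rewrite mul1mx.
    by move=> X1 X2 /UP h1 /UP h2; apply/UP => x xK; rewrite -mulmxA h1 ?h2.
  by move=> _ [->|->]; apply/UP => // x; exact: delB_delK.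
by apply; have := mem_delK_pow 0; rewrite expr0 mul1mx.
Qed.

Hypothesis g_reg : adjop g [ffun=> 1] = K *: [ffun=> 1] :> F.
Variable Z : {vspace F}.
Hypothesis Z_stable : {in Z, forall f, adjop g f \in Z}.
Hypotheses (Z_dfun : dfun R a \in Z) (Z_one : [ffun=> 1] \in Z).
Hypothesis Z_min : forall U : {vspace F},
  {in U, forall f, adjop g f \in U} -> dfun R a \in U -> (Z <= U)%VS.

(** By K-regularity, E 1 = K 1 - B 1. *)
Lemma delE_one_delK : E *m one \in dK.
Proof.
have oneK : one \in dK by have := mem_delK_pow 0; rewrite expr0 mul1mx.
have -> : E *m one = K *: one - B *m one.
  rewrite delE_one delone_restr delB_restr ffunE scale1r (linearB (adjop g)) /= g_reg.
  by rewrite (linearB restr) (linearZ_LR restr) /= opprB addrC subrK.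
by rewrite memvB ?memvZ ?delB_delK.
Qed.

(** For the inclusion of the right-hand side, the functions with restriction in
    R[B]1 form an A-stable space containing e_a, so they include Z. *)
Lemma delK_restr : dK = (linfun restr @: Z)%VS.
Proof.
apply/eqP; rewrite eqEsubv; apply/andP; split.
  apply: delK_min; elim=> [|k].
    rewrite expr0 mul1mx delone_restr -[restr _]lfunE; exact: memv_img.
  move=> /memv_imgP[f fZ]; rewrite lfunE /= exprS -mulmxA => ->.
  rewrite delB_restr -[restr _]lfunE; apply: memv_img.
  by apply: Z_stable; rewrite memvB ?memvZ.
apply/subvP => _ /memv_imgP[f fZ ->].
suff /subvP/(_ f fZ) : (Z <= linfun restr @^-1: dK)%VS by rewrite memv_preim.
apply: Z_min => [h|]; rewrite -!memv_preim !lfunE /=; last by rewrite restr_dfun mem0v.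
move=> hK; have := delB_delK hK; rewrite delB_restr (linearB (adjop g)) (linearZ_LR (adjop g)) /=
  (linearB restr) (linearZ_LR restr) /=.
move=> BK; rewrite -(subrK (h a *: restr (adjop g (dfun R a))) (restr _)).
by rewrite memvD ?memvZ // -delE_one delE_one_delK.
Qed.

Lemma dim_delK : \dim dK = (\dim Z - 1)%N.
Proof.
rewrite delK_restr -(limg_ker_dim (linfun restr) Z).
have -> : (Z :&: lker (linfun restr))%VS = <[dfun R a]>%VS.
  apply/eqP; rewrite eqEsubv; apply/andP; split.
    apply/subvP => f; rewrite memv_cap memv_ker lfunE /= => /andP[_ /eqP/restr_eq0 ->].
    by rewrite memvZ ?memv_line.
  by rewrite -memvE memv_cap memv_ker lfunE /= restr_dfun eqxx Z_dfun.
have d0 : dfun R a != 0 by apply/eqP => /ffunP/(_ a)/eqP; rewrite !ffunE eqxx oner_eq0.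
by rewrite dim_vline d0 addKn.
Qed.

Lemma delP_eq_delK :
  (forall f x y, f \in Z -> g a x -> g a y -> f x = f y) -> delP R g a = dK.
Proof.
move=> Zc; apply: delP_delK => v; rewrite {1}delK_restr => /memv_imgP[f fZ ->].
rewrite lfunE /=.
have [c cE] : exists c : R, forall x, g a x -> f x = c.
  have [/existsP[y ay]|/existsPn na] := boolP [exists y, g a y].
    by exists (f y) => x ax; apply: Zc.
  by exists 0 => x ax; have := na x; rewrite ax.
have -> : E *m restr f = c *: (E *m one).
  apply/colP => i; rewrite delE_restr mxE delone_restr delE_restr ffunE mulr1.
  by case: (boolP (g a _)) => [/cE ->|_]; rewrite ?mul1r ?mulr1 ?mul0r ?mulr0.
by rewrite memvZ ?delE_one_delK.
Qed.

End VertexDeletion.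

(** * Cartesian powers *)

Section CartesianPower.
Set Implicit Arguments.
Unset Strict Implicit.
Import Order.TTheory GRing.Theory Num.Theory.
Local Open Scope ring_scope.
Variables (R : realType) (T : finType) (e : rel T) (m : nat).
Hypotheses (e_sym : symmetric e) (e_irr : irreflexive e).

Local Notation G := (@cart_pow T e m).
Local Notation V := {ffun 'I_m -> T}.

Definition upd (u : V) i t : V := [ffun j => if j == i then t else u j].

Lemma cart_pow_sym : symmetric G.
Proof.
suff h u v : G u v -> G v u by move=> u v; apply/idP/idP; exact: h.
move=> /existsP[i /andP[uv /forallP o]]; apply/existsP; exists i.
by rewrite e_sym uv; apply/forallP => j; rewrite [v j == _]eq_sym; exact: o.
Qed.

(** The coordinate in which two adjacent tuples differ is unique, since e is
    irreflexive; the sum over the neighbours of u splits accordingly. *)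
Lemma adjop_cart_pow (f : {ffun V -> R^o}) u :
  adjop G f u = \sum_i \sum_(t | e (u i) t) f (upd u i t).
Proof.
rewrite ffunE.
pose P i (v : V) := e (u i) (v i) && [forall j, (j != i) ==> (u j == v j)].
rewrite (eq_bigr (fun v : V => \sum_(i | P i v) f v)); last first.
  move=> v /existsP[i iP]; rewrite (big_pred1 i) // => j; apply/idP/eqP => [|->//].
  move=> /andP[uvj _]; apply/eqP; apply: contraTT uvj => ji.
  by have /andP[_ /forallP/(_ j)] := iP; rewrite ji /= => /eqP ->; rewrite e_irr.
rewrite (exchange_big_dep xpredT) //=; apply: eq_bigr => i _.
rewrite (reindex_onto (upd u i) (fun v => v i)) /=; last first.
  move=> v /andP[_ /andP[_ /forallP o]]; apply/ffunP => j; rewrite ffunE.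
  by case: eqP => [->//|/eqP ji]; have := o j; rewrite ji => /eqP.
apply: eq_bigl => t; rewrite ffunE eqxx eqxx andbT.
have oth : [forall j, (j != i) ==> (u j == upd u i t j)].
  by apply/forallP => j; apply/implyP => ji; rewrite ffunE (negPf ji).
rewrite /P oth ffunE eqxx andbT; case eut: (e (u i) t); rewrite ?andbF // andbT.
by apply/existsP; exists i; rewrite ffunE eqxx eut.
Qed.

Definition tens (f : 'I_m -> {ffun T -> R^o}) : {ffun V -> R^o} :=
  [ffun u : V => \prod_i (f i (u i) : R)].

Lemma adjop_tens f (l : 'I_m -> R) : (forall i, adjop e (f i) = l i *: f i) ->
  adjop G (tens f) = (\sum_i l i) *: tens f.
Proof.
move=> fl; apply/ffunP => u; rewrite adjop_cart_pow !ffunE /GRing.scale /= mulr_suml.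
apply: eq_bigr => i _.
have /ffunP/(_ (u i)) := fl i; rewrite !ffunE => fli.
rewrite [in RHS](bigD1 i) //= mulrA -[l i * _]fli mulr_suml.
apply: eq_bigr => t _; rewrite ffunE (bigD1 i) //= ffunE eqxx; congr (_ * _).
by apply: eq_bigr => j ji; rewrite ffunE (negPf ji).
Qed.

Lemma dfun_tens r : dfun R ([ffun=> r] : V) = tens (fun=> dfun R r).
Proof.
apply/ffunP => u; rewrite !ffunE; case: eqP => [->|/eqP ur].
  by rewrite big1 // => i _; rewrite !ffunE eqxx.
have /existsP[i ui] : [exists i, u i != r].
  apply: contraNT ur => /existsPn ur; apply/eqP/ffunP => i; rewrite ffunE.
  by apply/eqP; have := ur i; rewrite negbK.
by rewrite (bigD1 i) //= ffunE (negPf ui) mul0r.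
Qed.

Lemma cart_pow_nbhd r u : G [ffun=> r] u -> exists i, e r (u i) /\ forall j, j != i -> u j = r.
Proof.
move=> /existsP[i /andP[]]; rewrite ffunE => eru /forallP o; exists i; split=> // j ji.
by have := o j; rewrite ji ffunE => /eqP.
Qed.

Section TensorEigenvectors.
Variables (r : T) (s : seq R) (w : R -> {ffun T -> R^o}) (k : R).
Hypotheses (e_conn : connected_graph e).
Hypotheses (s_uniq : uniq s) (Aw : forall l, adjop e (w l) = l *: w l).
Hypotheses (w_gt0 : {in s, forall l, 0 < w l r}) (dE : dfun R r = \sum_(l <- s) w l).
Hypothesis w_sphere : {in s, forall l, sphere_const e r (w l)}.
Hypotheses (ks : k \in s) (wk : forall x, w k x = w k r).
Hypothesis k_max : {in s, forall l, l <= k}.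

Local Notation I := {ffun 'I_m -> 'I_(size s)}.

(** Families of elements of Theta are indexed by functions from the coordinates
    to positions in the list s, which form a finite type. *)
Definition index_sum (t : I) : R := \sum_i s`_(t i).
Definition index_sums : seq R := undup [seq index_sum t | t : I].
Definition index_tens (t : I) := tens (fun i => w s`_(t i)).
Definition sum_eigenvector x := \sum_(t : I | index_sum t == x) index_tens t.
Definition sum_space := <<[seq sum_eigenvector x | x <- index_sums]>>%VS.

Lemma index_sumsP (Theta : set R) : (forall l, Theta l <-> l \in s) ->
  forall x, msumset m Theta x <-> x \in index_sums.
Proof.
move=> sE x; rewrite mem_undup; split=> [[u uT <-]|/fintype.imageP[t _ ->]].
  have /boolp.choice[t tE] : forall i, exists j : 'I_(size s), s`_j = u i.
    move=> i; have us : u i \in s by apply/sE; exact: uT.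
    have lt : (index (u i) s < size s)%N by rewrite index_mem.
    by exists (Ordinal lt); rewrite /= nth_index.
  apply/fintype.imageP; exists [ffun i => t i] => //; apply: eq_bigr => i _.
  by rewrite ffunE tE.
by exists (fun i => s`_(t i)) => // i; apply/sE; rewrite mem_nth.
Qed.

Lemma adjop_sum_eigenvector x :
  adjop G (sum_eigenvector x) = x *: sum_eigenvector x.
Proof.
rewrite linear_sum scaler_sumr; apply: eq_bigr => t /eqP <-.
by apply: adjop_tens => i; exact: Aw.
Qed.

Lemma sum_eigenvector_neq0 : {in index_sums, forall x, sum_eigenvector x != 0}.
Proof.
move=> x; rewrite mem_undup => /fintype.imageP[t _ xE].
have pos t' : 0 < index_tens t' [ffun=> r].
  by rewrite ffunE prodr_gt0 // => i _; rewrite ffunE w_gt0 // mem_nth.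
apply/eqP => /ffunP/(_ [ffun=> r]); rewrite sum_ffunE ffunE => /eqP.
rewrite psumr_eq0 => [/allP/(_ t)|t' _]; last exact: ltW.
by rewrite mem_index_enum xE eqxx gt_eqF // => /(_ isT).
Qed.

(** Expand the product over the coordinates of e_r(u_i) = sum of the w_l(u_i). *)
Lemma dfun_sum_eigenvectors :
  dfun R ([ffun=> r] : V) = \sum_(x <- index_sums) sum_eigenvector x.
Proof.
rewrite /sum_eigenvector (exchange_big_dep xpredT) //= dfun_tens.
apply/ffunP => u; rewrite sum_ffunE ffunE.
transitivity (\prod_i \sum_(j < size s) (w s`_j (u i) : R)).
  by apply: eq_bigr => i _; rewrite dE sum_ffunE (big_nth 0) big_mkord.
rewrite bigA_distr_bigA; apply: eq_bigr => t _.
rewrite (eq_bigl (pred1 (index_sum t))); last by move=> x; rewrite /= eq_sym.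
rewrite -[in RHS]big_filter filter_pred1_uniq ?undup_uniq ?big_seq1 ?ffunE //.
by rewrite mem_undup fintype.image_f.
Qed.

Lemma dim_sum_space : \dim sum_space = size index_sums.
Proof.
apply: (eigen_dim_span (A := adjop G)) (undup_uniq _) _ sum_eigenvector_neq0.
by move=> x _; exact: adjop_sum_eigenvector.
Qed.

Lemma sum_space_stable : {in sum_space, forall f, adjop G f \in sum_space}.
Proof.
apply: (eigen_span_stable (A := adjop G)) => x _; exact: adjop_sum_eigenvector.
Qed.

Lemma sum_space_dfun : dfun R ([ffun=> r] : V) \in sum_space.
Proof.
rewrite dfun_sum_eigenvectors big_seq memv_suml // => x xs.
by rewrite memv_span // map_f.
Qed.

Lemma sum_space_min (U : {vspace {ffun V -> R^o}}) :
    {in U, forall f, adjop G f \in U} -> dfun R ([ffun=> r] : V) \in U ->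
  (sum_space <= U)%VS.
Proof.
move=> UA; rewrite dfun_sum_eigenvectors; apply: (eigen_span_min (A := adjop G)) => //.
- exact: undup_uniq.
- by move=> x _; exact: adjop_sum_eigenvector.
Qed.

(** As k is the maximum of s, the sum m k is attained by the constant family
    only, and its tensor is constant because w_k is. *)
Lemma sum_space_one : [ffun=> 1] \in sum_space.
Proof.
have kt : (index k s < size s)%N by rewrite index_mem.
pose t0 : I := [ffun=> Ordinal kt].
have t0E i : s`_(t0 i) = k by rewrite ffunE nth_index.
have t0S : index_sum t0 = k *+ m.
  by rewrite /index_sum (eq_bigr (fun=> k)) ?sumr_const ?card_ord.
have wkr : w k r != 0 by rewrite gt_eqF ?w_gt0.
have -> : [ffun=> 1] = (w k r ^+ m)^-1 *: sum_eigenvector (k *+ m).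
  rewrite /sum_eigenvector (big_pred1 t0) => [|t]; last first.
    apply/eqP/eqP => [tE|->//]; apply/ffunP => i; apply/val_inj/eqP.
    rewrite /= -(nth_uniq 0 _ _ s_uniq) // t0E.
    have : \sum_i (k - s`_(t i)) == 0.
      by rewrite sumrB sumr_const card_ord -/(index_sum t) tE subrr.
    rewrite psumr_eq0 => [/allP/(_ i)|j _]; last by rewrite subr_ge0 k_max ?mem_nth.
    by rewrite mem_index_enum subr_eq0 eq_sym => /(_ isT).
  apply/ffunP => u; rewrite !ffunE (eq_bigr (fun=> w k r : R)).
    by rewrite prodr_const card_ord /GRing.scale /= mulVf // expf_neq0.
  by move=> i _; rewrite t0E wk.
rewrite memvZ // memv_span // map_f // mem_undup -t0S; exact: fintype.image_f.
Qed.

(** Two neighbours u, v of a have distance 1 to r in one coordinate each, i and j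
    say, and 0 elsewhere. So the distances of u are those of v after exchanging
    i and j, and this exchange permutes the tensors that make up an
    eigenvector. *)
Lemma sum_space_nbhd_const f u v : f \in sum_space ->
  G [ffun=> r] u -> G [ffun=> r] v -> f u = f v.
Proof.
move=> fZ /cart_pow_nbhd[i [eu ou]] /cart_pow_nbhd[j [ev ov]].
have d1 x : e r x -> gdist e r x = 1%N.
  move=> rx; have xr : x != r by apply: contraTneq rx => ->; rewrite e_irr.
  have d0 : gdist e r r = 0%N by apply/eqP; rewrite gdist_eq0.
  apply/eqP; rewrite eqn_leq lt0n gdist_eq0 // xr andbT.
  by have := gdist_step e_conn r rx; rewrite d0.
pose p := tperm i j.
have duv h : gdist e r (u h) = gdist e r (v (p h)).
  rewrite /p; case: tpermP => [->|->|hi hj]; first by rewrite !d1 //.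
    have [ij|ij] := eqVneq i j; first by rewrite ij in eu *; rewrite !d1.
    by rewrite ou 1?eq_sym // ov.
  by rewrite ou ?ov //; apply/eqP.
have tuv t : index_tens t u = index_tens [ffun h => t (p h)] v.
  rewrite !ffunE (reindex_inj (@perm_inj _ p)) /=; apply: eq_bigr => h _.
  rewrite ffunE; apply: w_sphere; first exact: mem_nth.
  by rewrite duv tpermK.
have suv x : sum_eigenvector x u = sum_eigenvector x v.
  rewrite !sum_ffunE (reindex_inj (h := fun t : I => [ffun h => t (p h)])) /=; last first.
    move=> t1 t2 /ffunP t12; apply/ffunP => h.
    by have := t12 (p h); rewrite !ffunE tpermK.
  apply: eq_big => t.
    by rewrite /index_sum [in RHS](reindex_inj (@perm_inj _ p)) /=;
      under eq_bigr do rewrite ffunE.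
  move=> _; rewrite tuv; congr (index_tens _ v).
  by apply/ffunP => h; rewrite !ffunE tpermK.
move: fZ; rewrite /sum_space -[map _ _]/(val (in_tuple [seq sum_eigenvector x | x <- index_sums])).
move=> /coord_span ->; rewrite !sum_ffunE; apply: eq_bigr => h _.
rewrite [LHS]ffunE [RHS]ffunE (nth_map 0) ?suv //.
by apply: leq_trans (ltn_ord h) _; rewrite size_map.
Qed.

End TensorEigenvectors.
End CartesianPower.

(** * Vertex-deleted Cartesian powers *)

Section CartesianPowerVertexDeleted.
Set Implicit Arguments.
Unset Strict Implicit.
Import Order.TTheory GRing.Theory Num.Theory.
Local Open Scope ring_scope.
Variables (R : realType) (T : finType) (e : rel T) (r : T) (k m : nat).
Hypotheses (e_sym : symmetric e) (e_irr : irreflexive e).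
Hypotheses (e_conn : connected_graph e) (e_reg : forall x, #|nbhd e x| = k).
Hypothesis e_eqt : equitable e (distance_partition e r).

Local Notation D := (ecc e r).
Local Notation G := (@cart_pow T e m).
Local Notation Theta := (local_support R e r).
Local Notation a := ([ffun => r] : {ffun 'I_m -> T}).

Lemma cart_pow_delP :
  exists s S : seq R,
  [/\ uniq s, forall l, Theta l <-> l \in s, size s = D.+1 &
   [/\ uniq S, forall x, msumset m Theta x <-> x \in S,
       delP R G a = delK R G a & \dim (delK R G a) = (size S - 1)%N]].
Proof.
have [s [w [us sE szs [Aw w_gt0 dE w_sph [ks wk k_max]]]]] :=
  local_support_structure R e_conn e_sym e_reg e_eqt.
have G_sym := cart_pow_sym (m := m) e_sym.
have G_reg : adjop G [ffun=> 1] = (\sum_(i < m) (k%:R : R)) *: [ffun=> 1] :> {ffun _ -> R^o}.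
  have -> : [ffun=> 1] = tens (m := m) (fun=> [ffun=> 1]) :> {ffun {ffun 'I_m -> T} -> R^o}.
    by apply/ffunP => u; rewrite !ffunE big1 // => i _; rewrite ffunE.
  by apply: adjop_tens => // i; exact: adjop_const1.
have Zst := sum_space_stable (m := m) e_irr (s := s) Aw.
have Zd := sum_space_dfun m dE.
have Z1 := sum_space_one m us w_gt0 ks wk k_max.
have Zmin := sum_space_min (m := m) e_irr Aw dE.
exists s, (index_sums m s); split=> //; split.
- exact: undup_uniq.
- exact: index_sumsP.
- apply: (delP_eq_delK G_sym G_reg Zst Zd Z1 Zmin) => f u v.
  exact: (sum_space_nbhd_const e_irr e_conn w_sph).
- rewrite (dim_delK G_sym G_reg Zst Zd Z1 Zmin).
  by rewrite (dim_sum_space _ e_irr Aw w_gt0).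
Qed.

End CartesianPowerVertexDeleted.

Lemma card_fset_set_seq (R : realType) (A : set R) (S : seq R) : uniq S ->
  (forall x, A x <-> x \in S) -> #|` fset_set A|%fset = size S.
Proof.
move=> uS AS.
have -> : A = [set` [fset x in S]%fset]%classic.
  by apply/seteqP; split=> x; rewrite /= inE; move=> /AS.
rewrite set_fsetK card_fseq undup_id //.
Qed.

Theorem theorem4p2 (R : realType) (T : finType) (e : rel T) (r : T) (m : nat)
    (e_graph : simple_graph e) (e_conn : connected_graph e)
    (e_reg : regular_graph e)
    (e_eqt : equitable e (distance_partition e r))
    (D_ge1 : (1 <= ecc e r)%N) (m_ge1 : (1 <= m)%N) :
  let D := ecc e r in
  let Theta : set R := local_support R e r in
  let G := @cart_pow T e m in
  let a : {ffun 'I_m -> T} := [ffun => r] in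
  let P := delP R G a in
  let card_mTheta := #|` fset_set (msumset m Theta)|%fset in
  [/\ P = delK R G a,
      \dim P = (card_mTheta - 1)%N,
      (m * D <= card_mTheta - 1)%N,
      (2 <= m)%N -> (\dim P = (m * D)%N <-> arith_prog Theta) &
      distance_regular e -> D = diam e /\ Theta = spectrum R e].
Proof.
move=> D Theta G a P card_mTheta.
have [e_sym e_irr] := e_graph; have [k e_deg] := e_reg.
have [s [S [us sE szs [uS SE PK dimK]]]] :=
  cart_pow_delP R m e_sym e_irr e_conn e_deg e_eqt.
have cardE : card_mTheta = size S by apply: card_fset_set_seq.
have ge := sumset_size_ge us sE szs uS SE m_ge1.
rewrite /P PK dimK cardE; split=> //.
- by rewrite -/D in ge; lia.
- move=> m2; split=> [dimE|AP].
    apply: (sumset_eq_arith_prog us sE szs uS SE m_ge1 m2 D_ge1).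
    by rewrite -/D in ge *; lia.
  have := arith_prog_sumset_size sE szs uS SE AP.
  by rewrite -/D in ge *; lia.
- exact: distance_regular_support.
Qed.
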